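(* Let $M$ be a compact Riemannian manifold without boundary and let $W\in C^{1,\alpha}(M\times M)$ for some $\alpha>0$ be symmetric. Then for each weak solution $(\mu_t)_{t\ge0}$ of $$\partial_t\mu-\operatorname{div}\left(\frac{1}{m_\mu}\mathcal{J}_2(\mathcal{D}W[\mu])\,\mu\right)=0\quad\text{on }(0,\infty)\times M$$ there exist times $t_n\to\infty$ such that $\mu_{t_n}$ converges narrowly to a stationary solution of this equation.
   Context: $|\cdot|$ is the Riemannian norm on tangent spaces $T_xM$ and $|\cdot|_*$ the dual norm. $\mathcal{P}(M)$ is the space of Borel probability measures on $M$ with the narrow topology. $K\in C(M\times M)$ is a continuous kernel for which there is a constant $C>0$ with $K(x,y)\ge C$ for all $x,y\in M$; $m_\mu(x)=\int_M K(x,y)\,d\mu(y)$ and $W[\mu](x)=\int_M W(x,y)\,d\mu(y)$ for $\mu\in\mathcal{P}(M)$. $\mathcal{D}$ denotes the differential on $M$, and $\mathcal{J}_2:\xi\in T_x^*M\mapsto|\xi|_*\operatorname{arg\,max}_{y\in T_xM,\,|y|=1}\xi(y)\in T_xM$ (with $\mathcal{J}_2(0)=0$) is the Riesz isomorphism. A weak solution on $[0,\infty)$ is a narrowly continuous curve $t\mapsto\mu_t\in\mathcal{P}(M)$ such that, with $v_t=-\frac1{m_{\mu_t}}\mathcal{J}_2(\mathcal{D}W[\mu_t])$, for every $T>0$ $$\int_0^T\int_M\partial_t\varphi(x,t)+\langle\mathcal{D}\varphi(x,t),v_t(x)\rangle\,d\mu_t(x)\,dt=0\quad\forall\varphi\in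 C^1_c(M\times(0,T)).$$ A stationary solution is a measure $\mu^*\in\mathcal{P}(M)$ such that the constant curve $\mu_t\equiv\mu^*$ is a weak solution. The transformer dynamics correspond to $M=\mathcal{S}$ the unit sphere, $K(x,y)=e^{x\cdot Dy}$ and $W(x,y)=\pm e^{x\cdot Dy}$ with $D$ a symmetric matrix. *)

(* Defs.v *)
From HB Require Import structures.
From mathcomp Require Import all_boot all_order all_algebra.
From mathcomp Require Import all_classical all_reals all_analysis.

Set Implicit Arguments.
Unset Strict Implicit.
Unset Printing Implicit Defensive.

Import Order.TTheory GRing.Theory Num.Theory.
Import numFieldNormedType.Exports.

Local Open Scope classical_set_scope.
Local Open Scope ring_scope.

Section Regularity.
Context {R : realType} {V W : normedModType R}.

(* Only used for finite-dimensional [V] and open [U], where quantifying over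
   all directions [v] gives the usual classes C^k(U). *)
Fixpoint Ck_on (k : nat) (U : set V) (f : V -> W) : Prop :=
  (forall p, U p -> {for p, continuous f}) /\
  match k with
  | 0%N => True
  | k'.+1 => forall v : V, (forall p, U p -> derivable f p v) /\
                           Ck_on k' U (fun p => 'D_v f p)
  end.

Definition smooth_on (U : set V) (f : V -> W) : Prop :=
  forall k : nat, Ck_on k U f.

(* The Hoelder condition is local; on a compact manifold, imposing it in all
   charts is the same as a uniform condition over a finite atlas. *)
Definition C1_holder_on (a : R) (U : set V) (f : V -> W) : Prop :=
  Ck_on 1 U f /\
  forall (v p : V), U p -> exists C : R,
    \forall q & r \near p, `|'D_v f q - 'D_v f r| <= C * `|q - r| `^ a.

End Regularity.

(* A smooth [d]-dimensional manifold without boundary: charts take values in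
   open subsets of R^d.  [chart i] and [chart_inv i] are meaningful only on
   [chart_dom i] and [chart i @` chart_dom i], respectively. *)
Record smoothManifold (R : realType) (d : nat) (M : ptopologicalType) := {
  atlas : Type ;
  chart_dom : atlas -> set M ;
  chart : atlas -> M -> 'rV[R]_d ;
  chart_inv : atlas -> 'rV[R]_d -> M ;
  chart_at : M -> atlas ;
  manifold_hausdorff : hausdorff_space M ;
  manifold_second_countable : @second_countable M ;
  chart_dom_open : forall i, open (chart_dom i) ;
  chart_img_open : forall i, open (chart i @` chart_dom i) ;
  chart_continuous : forall i, {within chart_dom i, continuous (chart i)} ;
  chart_inv_continuous : forall i,
    {within chart i @` chart_dom i, continuous (chart_inv i)} ;
  chartK : forall i x, chart_dom i x -> chart_inv i (chart i x) = x ;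
  chart_at_dom : forall x, chart_dom (chart_at x) x ;
  transition_smooth : forall i j,
    smooth_on (chart i @` (chart_dom i `&` chart_dom j))
              (chart j \o chart_inv i)
}.

Definition chart_img (R : realType) (d : nat) (M : ptopologicalType)
    (A : smoothManifold R d M) (i : atlas A) : set 'rV[R]_d :=
  chart i @` chart_dom i.

Definition bilin (R : realType) (d : nat) (G : 'M[R]_d) (y z : 'rV[R]_d) : R :=
  (y *m G *m z^T) 0 0.

(* [gram i x] is the matrix of the inner product on T_xM in the coordinates of
   chart [i], for [x] in its domain; the last field is the transformation law
   of a (0,2)-tensor. *)
Record riemannianMetric (R : realType) (d : nat) (M : ptopologicalType)
    (A : smoothManifold R d M) := {
  gram : atlas A -> M -> 'M[R]_d ;
  gram_sym : forall i x, chart_dom i x -> (gram i x)^T = gram i x ;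
  gram_pos : forall i x (y : 'rV[R]_d),
    chart_dom i x -> y != 0 -> 0 < bilin (gram i x) y y ;
  gram_smooth : forall i, smooth_on (chart_img i) (gram i \o chart_inv i) ;
  gram_transition : forall i j x (y z : 'rV[R]_d),
    chart_dom i x -> chart_dom j x ->
    bilin (gram i x) y z =
      bilin (gram j x) ('D_y (chart j \o chart_inv i) (chart i x))
                       ('D_z (chart j \o chart_inv i) (chart i x))
}.

(* T_xM and its dual are identified with row vectors through the preferred
   chart [chart_at x], using the coordinate basis and its dual basis. *)
Section Tangent.
Context {R : realType} {d : nat} {M : ptopologicalType}.
Context {A : smoothManifold R d M} (g : riemannianMetric A).

Definition pairing (xi y : 'rV[R]_d) : R := \sum_k xi 0 k * y 0 k.

Definition tangent_norm (x : M) (y : 'rV[R]_d) : R :=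
  Num.sqrt (bilin (gram g (chart_at A x) x) y y).

Definition dual_norm (x : M) (xi : 'rV[R]_d) : R :=
  sup [set pairing xi y | y in [set y | tangent_norm x y <= 1]].

(* For [xi = 0] the maximizer is not unique, but it is scaled by 0. *)
Definition J2 (x : M) (xi : 'rV[R]_d) : 'rV[R]_d :=
  dual_norm x xi *:
    xget 0 [set y | tangent_norm x y = 1 /\
                    forall z, tangent_norm x z = 1 ->
                              pairing xi z <= pairing xi y].

End Tangent.

Section Calculus.
Context {R : realType} {d : nat} {M : ptopologicalType}.
Variable A : smoothManifold R d M.

Definition differential (f : M -> R) (x : M) : 'rV[R]_d :=
  \row_k 'D_(delta_mx 0 k) ((f \o chart_inv (chart_at A x)) : 'rV[R]_d -> R^o)
           (chart (chart_at A x) x).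

Definition C1_holder_manifold2 (a : R) (W : M * M -> R) : Prop :=
  forall i j : atlas A,
    C1_holder_on a (chart_img i `*` chart_img j)
      (fun p : 'rV[R]_d * 'rV[R]_d =>
         W (chart_inv i p.1, chart_inv j p.2) : R^o).

(* C^1_c(M x (0,T)), with functions extended by zero to M x R. *)
Definition test_function (T : R) (phi : M * R -> R) : Prop :=
  (forall i : atlas A,
     Ck_on 1 (chart_img i `*` [set` `]0, T[])
       (fun p : 'rV[R]_d * R^o => phi (chart_inv i p.1, p.2) : R^o)) /\
  exists2 S : set (M * R),
    compact S /\ S `<=` [set: M] `*` [set` `]0, T[] &
    forall p, ~ S p -> phi p = 0.

End Calculus.

(* The space P(M) of Borel probability measures. *)
Notation borelProb R M := (probability (g_sigma_algebraType (@open M)) R).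

Definition narrow_cvg (R : realType) (M : ptopologicalType) (I : Type)
    (F : set_system I) (mu : I -> borelProb R M) (nu : borelProb R M) : Prop :=
  forall f : M -> R^o, continuous f -> bounded_fun f ->
    (fun i => \int[mu i]_x f x) @ F --> (\int[nu]_x f x : R).

Definition kernel_avg (R : realType) (M : ptopologicalType) (K : M * M -> R)
    (mu : borelProb R M) (x : M) : R :=
  \int[mu]_y K (x, y).

Section Equation.
Context {R : realType} {d : nat} {M : ptopologicalType}.
Context {A : smoothManifold R d M} (g : riemannianMetric A).
Variables K W : M * M -> R.

Definition velocity (mu : borelProb R M) (x : M) : 'rV[R]_d :=
  - ((kernel_avg K mu x)^-1 *: J2 g x (differential A (kernel_avg W mu) x)).

(* Only the values of [mu] at nonnegative times matter. *)
Definition weak_solution (mu : R -> borelProb R M) : Prop :=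
  (forall t : R, 0 <= t ->
     narrow_cvg (within [set s | 0 <= s] (nbhs t)) mu (mu t)) /\
  forall T : R, 0 < T -> forall phi : M * R -> R, test_function A T phi ->
    \int[lebesgue_measure]_(t in `]0, T[)
      \int[mu t]_x ('D_1 (fun s : R^o => phi (x, s) : R^o) t
        + pairing (differential A (fun y => phi (y, t)) x)
                  (velocity (mu t) x)) = 0.

Definition stationary_solution (mu : borelProb R M) : Prop :=
  weak_solution (fun=> mu).

End Equation.

(* Main.v *)
From HB Require Import structures.
Require Import Defs.
From mathcomp Require Import all_boot all_order all_algebra.
From mathcomp Require Import all_classical all_reals all_analysis.
From mathcomp Require Import measurable_realfun lra ring.

Set Implicit Arguments.
Unset Strict Implicit.
Unset Printing Implicit Defensive.

Import Order.TTheory GRing.Theory Num.Theory.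
Import numFieldNormedType.Exports.
Local Open Scope classical_set_scope.
Local Open Scope ring_scope.

(** The equation is the gradient flow, with mobility [1 / m_mu], of the
    interaction energy [E(mu) = 1/2 int W[mu] dmu], and the theorem expresses that
    a bounded energy cannot decay at a definite rate forever.

    Energy balance.  Testing the equation with [f(x) eta(t)] shows that
    [t |-> int f dmu_t] has the weak derivative [- int <df, J2 dW[mu_t]> / m dmu_t].
    This is continuous in [t], so by the lemma of du Bois-Reymond it is a
    classical derivative ([weak_derivative_is_derive], [potential_decay]).
    Since [W] is symmetric, [2 E(mu_{t+h}) - 2 E(mu_t)] is the increment over
    [[t, t+h]] of [r |-> int (W[mu_{t+h}] + W[mu_t]) dmu_r], whose potential does
    not depend on [r]; hence [dE/dt = - slope(mu_t, mu_t)] with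
    [slope(mu, mu) = int |dW[mu]|^2 / m_mu dmu >= 0] ([energy_derive]).  As [E] is
    bounded, the mean value theorem on [[n, 2n]] yields times [s_n >= n] with
    [slope(mu_{s_n}, mu_{s_n}) = O(1/n)] ([slope_vanishes]).

    Compactness.  The probability measures on a compact second countable
    Hausdorff space are sequentially compact for the narrow topology
    ([narrow_subsequence]).  The limit is built without a representation theorem
    for functionals: an ultrafilter limit of the measures is a finitely additive
    set function, its values on closed sets determine an outer measure for which
    open sets are Caratheodory measurable ([closed_content_prob]), and a
    portmanteau argument gives narrow convergence ([portmanteau]).

    Passing to the limit.  The slope is continuous for the narrow topology
    ([slope_cvg]): in a chart the partial derivatives of [W[mu]] are integrals
    against [mu] of continuous kernels, so they converge uniformly when [mu] does.
    Therefore the limit measure has slope zero, its velocity field vanishes almost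
    everywhere, and only the time derivative of the test function is left in the
    weak formulation; it integrates to zero ([slope0_stationary]).

    All pointwise statements about gradients are made in a chart.  The
    coordinate-free expression of the equation uses a preferred chart at each
    point, which varies without any continuity; the invariance of
    [df G^-1 dh^T] under a change of chart ([gradprodE]) removes this choice. *)

(** * Integration of continuous functions on a compact space *)

Lemma continuous_bounded {R : realType} {X : topologicalType} (f : X -> R) :
  compact [set: X] -> continuous f ->
  exists2 B : R, 0 < B & forall x, `|f x| <= B.
Proof.
move=> cX cf; have cf' : {within [set: X], continuous f}.
  exact: continuous_subspaceT.
have /compact_bounded[B [_ HB]] := continuous_compact cf' cX.
exists (`|B| + 1) => [|x]; first by rewrite ltr_pwDr.
by apply: (HB (`|B| + 1)); [rewrite ltr_pwDr// ler_norm | exists x].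
Qed.

Section CompactIntegration.
Context {R : realType} {M : ptopologicalType}.
Hypothesis cM : compact [set: M].
Implicit Types (mu nu : borelProb R M) (f : M -> R).

Lemma open_borel (U : set M) :
  open U -> measurable (U : set (g_sigma_algebraType (@open M))).
Proof. by move=> oU; apply: sub_sigma_algebra. Qed.

Lemma closed_borel (F : set M) :
  closed F -> measurable (F : set (g_sigma_algebraType (@open M))).
Proof.
move=> cF; rewrite -[F]setCK; apply: measurableC; apply: open_borel.
exact: closed_openC.
Qed.

Lemma continuous_borel f : continuous f ->
  measurable_fun [set: g_sigma_algebraType (@open M)] f.
Proof.
move=> /continuousP cf; apply: (measurability _ (@RGenOpens.measurableE R)).
move=> _ [_ [a [b ->] <-]]; rewrite setTI.
by apply: open_borel; apply: cf; exact: interval_open.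
Qed.

Lemma bounded_int mu f (B : R) :
  measurable_fun [set: g_sigma_algebraType (@open M)] f ->
  (forall x, `|f x| <= B) -> mu.-integrable setT (EFin \o f).
Proof.
move=> mf fB; apply: measurable_bounded_integrable => //.
  by rewrite (le_lt_trans (@sprobability_setT _ _ _ mu))// ltry.
exists B; split; first exact: num_real.
by move=> C BC x _; exact: le_trans (fB x) (ltW BC).
Qed.

Lemma continuous_int mu f : continuous f -> mu.-integrable setT (EFin \o f).
Proof.
move=> cf; have [B _ fB] := continuous_bounded cM cf.
by apply: bounded_int fB; exact: continuous_borel.
Qed.

Lemma int_cst mu (r : R) : \int[mu]_x r = r.
Proof. by rewrite Rintegral_cst//= (probability_setT mu) mulr1. Qed.

Lemma int_norm_le mu f (e : R) : mu.-integrable setT (EFin \o f) ->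
  (forall x, `|f x| <= e) -> `|\int[mu]_x f x| <= e.
Proof.
move=> If fe; apply: le_trans (le_normr_Rintegral _ If) _ => //.
rewrite -[leRHS](int_cst mu); apply: le_Rintegral => //.
- exact: integrable_norm.
- by apply: (@bounded_int _ _ `|e|) => //.
Qed.

Lemma int_dist_le mu f f' (e : R) : continuous f -> continuous f' ->
  (forall x, `|f x - f' x| <= e) -> `|\int[mu]_x f x - \int[mu]_x f' x| <= e.
Proof.
move=> cf cf' ffe.
rewrite -RintegralB//; [|exact: continuous_int..].
apply: int_norm_le => //; apply: continuous_int.
by move=> x; apply: (@continuousB _ R^o _ f f'); [exact: cf|exact: cf'].
Qed.

Lemma integrable_addr mu (f f' : M -> R) : mu.-integrable setT (EFin \o f) ->
  mu.-integrable setT (EFin \o f') ->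
  mu.-integrable setT (EFin \o (fun x => f x + f' x)).
Proof. by move=> If If'; exact: (integrableD _ If If'). Qed.

Lemma integrable_scaler mu (a : R) (f : M -> R) :
  mu.-integrable setT (EFin \o f) ->
  mu.-integrable setT (EFin \o (fun x => a * f x)).
Proof. by move=> If; exact: (integrableZl _ _ If). Qed.

Section ContinuousConvergence.
Context {I : Type} (F : set_system I) {FF : ProperFilter F}.

(** Continuous convergence: [u i x' --> u0 x] jointly as [x' --> x] and
    [i] follows [F]. On a compact space it is uniform convergence to a
    continuous limit, but unlike uniform convergence it can be checked in
    one chart at a time, and it is inherited by algebraic operations. *)
Definition ccvg (u : I -> M -> R) (u0 : M -> R) : Prop :=
  forall x, (fun p : M * I => u p.2 p.1) @ filter_prod (nbhs x) F --> u0 x.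

Lemma ccvg_continuous u u0 : ccvg u u0 -> continuous u0.
Proof.
move=> uu0 x; apply/cvgrPdist_lt => e e0.
have e20 : 0 < e / 2 by rewrite divr_gt0.
have /cvgrPdist_lt/(_ _ e20)[[A B] [/= xA FB] AB] := uu0 x.
near=> x'; have Ax' : A x' by near: x'.
have /cvgrPdist_lt/(_ _ e20)[[A' B'] [/= xA' FB'] AB'] := uu0 x'.
have [i [Bi B'i]] := filter_ex (filterI FB FB').
have h1 := AB (x', i) (conj Ax' Bi).
have h2 := AB' (x', i) (conj (nbhs_singleton xA') B'i).
rewrite /= in h1 h2.
rewrite -(subrKA (u i x')) (le_lt_trans (ler_normD _ _))//.
by rewrite (distrC (u i x')) (splitr e) ltrD.
Unshelve. all: by end_near. Qed.

Lemma ccvg_uniform u u0 (e : R) : 0 < e -> ccvg u u0 ->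
  \forall i \near F, forall x, `|u i x - u0 x| < e.
Proof.
move=> e0 uu0; have cu0 := ccvg_continuous uu0.
have e20 : 0 < e / 2 by rewrite divr_gt0.
suff : \forall i \near F, [set: M] `<=` (fun x => `|u i x - u0 x| < e).
  by apply: filterS => i /= H x; exact: H.
move/compact_near_coveringP : (cM); apply => x _.
have /cvgrPdist_lt/(_ _ e20)[[A B] [/= xA FB] AB] := uu0 x.
have /cvgrPdist_lt/(_ _ e20) xC := cu0 x.
exists (A `&` [set t | `|u0 x - u0 t| < e / 2], B).
  by split => //; exact: filterI.
move=> [x' i] [/= [Ax' Cx'] Bi]; have h1 := AB (x', i) (conj Ax' Bi).
rewrite /= in h1.
rewrite -(subrKA (u0 x)) (le_lt_trans (ler_normD _ _))//.
by rewrite (distrC (u i x')) (splitr e) ltrD.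
Qed.

(** Narrow convergence only controls a fixed integrand; uniformity lets the
    integrand move with the measure. *)
Lemma ccvg_int u u0 (mu : I -> borelProb R M) nu :
  (\forall i \near F, continuous (u i)) -> ccvg u u0 ->
  narrow_cvg F mu nu ->
  (fun i => \int[mu i]_x u i x) @ F --> (\int[nu]_x u0 x : R).
Proof.
move=> cu uu0 munu; have cu0 := ccvg_continuous uu0.
have b0 : bounded_fun (u0 : M -> R^o).
  have [B B0 HB] := continuous_bounded cM cu0.
  exists B; split; first exact: num_real.
  by move=> C BC x _; exact: le_trans (HB x) (ltW BC).
have munu0 := munu u0 cu0 b0.
apply/cvgrPdist_lt => e e0; have e20 : 0 < e / 2 by rewrite divr_gt0.
move/cvgrPdist_lt : munu0 => /(_ _ e20) h1.
have h2 := ccvg_uniform e20 uu0.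
near=> i.
rewrite -(subrKA (\int[mu i]_x u0 x)) (le_lt_trans (ler_normD _ _))//.
rewrite (splitr e) ltr_leD//; first by near: i.
rewrite distrC; apply: int_dist_le => //; first by near: i.
by move=> x; apply: ltW; move: x; near: i.
Unshelve. all: by end_near. Qed.

End ContinuousConvergence.

(** Joint continuity of [(p, mu) |-> int Phi(p, y) dmu(y)]. *)
Lemma kernel_int_cvg (X : topologicalType) (Phi : X * M -> R) (p : X)
    (I : Type) (F : set_system I) {FF : ProperFilter F}
    (mu : I -> borelProb R M) nu :
  (forall y, {for (p, y), continuous Phi}) ->
  (\forall q \near p, continuous (fun y => Phi (q, y))) ->
  narrow_cvg F mu nu ->
  (fun qi : X * I => \int[mu qi.2]_y Phi (qi.1, y)) @ filter_prod (nbhs p) F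
     --> (\int[nu]_y Phi (p, y) : R).
Proof.
move=> cPhi cPhiq munu.
apply: (@ccvg_int _ (filter_prod (nbhs p) F) _ (fun qi y => Phi (qi.1, y))
   (fun y => Phi (p, y)) (fun qi => mu qi.2)).
- exact: (cvg_fst cPhiq).
- move=> y; apply: (cvg_comp (fun q : M * (X * I) => (q.2.1, q.1)) Phi _
    (cPhi y)).
  apply: (@cvg_pair _ _ _ _ (nbhs p) (nbhs y)).
    exact: (cvg_comp _ _ cvg_snd cvg_fst).
  exact: cvg_fst.
- by move=> f cf bf; apply: (cvg_comp _ _ cvg_snd (munu f cf bf)).
Qed.

End CompactIntegration.

(** * From a finitely additive content on closed sets to a measure *)

Section ClosedContent.
Context {R : realType} {M : ptopologicalType}.
Hypotheses (hM : hausdorff_space M) (cM : compact [set: M]).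
Variable m : set M -> R.
Hypotheses (m0 : m set0 = 0) (mT : m [set: M] = 1).
Hypothesis m_mono : forall F G, closed F -> closed G -> F `<=` G -> m F <= m G.
Hypothesis m_add : forall F G, closed F -> closed G -> [disjoint F & G] ->
  m (F `|` G) = m F + m G.
Hypothesis m_sub : forall F G, closed F -> closed G ->
  m (F `|` G) <= m F + m G.

Local Open Scope ereal_scope.

(** Inner regularization of [m] on open sets, and the outer measure that it
    induces. *)
Definition open_content (U : set M) : \bar R :=
  ereal_sup [set (m F)%:E | F in [set F | closed F /\ F `<=` U]].

Definition content_outer (A : set M) : \bar R :=
  ereal_inf [set open_content U | U in [set U | open U /\ A `<=` U]].

Local Notation lam := open_content.
Local Notation mo := content_outer.

Let m_le1 F : closed F -> (m F <= 1)%R.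
Proof. by move=> cF; rewrite -mT; apply: m_mono => //; exact: closedT. Qed.

Let lam_ub U F : closed F -> F `<=` U -> (m F)%:E <= lam U.
Proof. by move=> cF FU; apply: ereal_sup_ubound; exists F. Qed.

Let lam_le U x : (forall F, closed F -> F `<=` U -> (m F)%:E <= x) -> lam U <= x.
Proof. by move=> h; apply: ge_ereal_sup => _ [F [cF FU] <-]; exact: h. Qed.

Let lam_ge0 U : 0 <= lam U.
Proof.
have := @lam_ub U set0 (@closed0 _) (@sub0set _ _).
by rewrite m0.
Qed.

Let lam_le1 U : lam U <= 1.
Proof. by apply: lam_le => F cF _; rewrite lee_fin m_le1. Qed.

Let lam_mono U V : U `<=` V -> lam U <= lam V.
Proof.
by move=> UV; apply: lam_le => F cF FU; apply: lam_ub => //; apply: subset_trans UV.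
Qed.

(** Normality splits a closed subset of [U `|` V] into a closed subset of [U]
    and one of [V]. *)
Let lamU U V : open U -> open V -> lam (U `|` V) <= lam U + lam V.
Proof.
move=> oU oV; apply: lam_le => F cF FUV.
have cFV : closed (F `\` V) by apply: closedI => //; exact: open_closedC.
have : set_nbhs (F `\` V) U.
  apply/set_nbhsP; exists U; split => // x [Fx nVx].
  by have [//|] := FUV x Fx.
move/(compact_normal hM cM cFV) => [C /set_nbhsP[D [oD FD DC]] CU].
apply: (@le_trans _ _ (m (F `&` closure C) + m (F `\` D))%:E).
  rewrite lee_fin; have cFC : closed (F `&` closure C).
    by apply: closedI => //; exact: closed_closure.
  have cFD : closed (F `\` D) by apply: closedI => //; exact: open_closedC.
  apply: le_trans (m_sub cFC cFD); apply: m_mono => //; first exact: closedU.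
  move=> x Fx; have [Dx|nDx] := pselect (D x); last by right.
  by left; split => //; apply: subset_closure; exact: DC.
rewrite EFinD; apply: leeD; apply: lam_ub.
- by apply: closedI => //; exact: closed_closure.
- by move=> x [_ /CU].
- by apply: closedI => //; exact: open_closedC.
- by move=> x [Fx nDx]; apply: contrapT => nVx; apply: nDx; exact: FD.
Qed.

Let lam_bigU (U : (set M)^nat) n : (forall i, open (U i)) ->
  lam (\bigcup_(i < n) U i) <= \sum_(i < n) lam (U i).
Proof.
move=> oU; elim: n => [|n IH].
  rewrite bigcup_mkord !big_ord0; apply: lam_le => F _.
  by rewrite subset0 => ->; rewrite m0.
rewrite bigcup_mkord !big_ord_recr/= -bigcup_mkord.
apply: le_trans (lamU _ (oU n)) _; last exact: leeD.
by apply: bigcup_open => i _; exact: oU.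
Qed.

(** A closed set is compact, so finitely many of the open sets cover it. *)
Let lam_sigma (U : (set M)^nat) : (forall i, open (U i)) ->
  lam (\bigcup_i U i) <= \sum_(i <oo) lam (U i).
Proof.
move=> oU; apply: lam_le => F cF FU.
have /compact_near_coveringP : compact F by exact: subclosed_compact cF cM _.
move=> /(_ _ \oo (fun n => \bigcup_(i < n) U i) _)[].
  move=> x Fx; have [i _ Uix] := FU x Fx.
  exists (U i, [set n | (i < n)%N]).
    by split => //=; [exact: open_nbhs_nbhs|exact: nbhs_infty_gt].
  by move=> [x' n] [/= Ux' ?]; exists i.
move=> n _ /(_ n (leqnn n)) Fn.
apply: (@le_trans _ _ (lam (\bigcup_(i < n) U i))); first exact: lam_ub.
apply: le_trans (lam_bigU n oU) _.
rewrite -(big_mkord predT (fun i => lam (U i))).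
exact: nneseries_lim_ge.
Qed.

Let mo_le U A : open U -> A `<=` U -> mo A <= lam U.
Proof. by move=> oU AU; apply: ereal_inf_lbound; exists U. Qed.

Let mo_ge A x : (forall U, open U -> A `<=` U -> x <= lam U) -> x <= mo A.
Proof. by move=> h; apply: le_ereal_inf_tmp => _ [U [oU AU] <-]; exact: h. Qed.

Let mo_open U : open U -> mo U = lam U.
Proof.
move=> oU; apply/eqP; rewrite eq_le mo_le//=.
by apply: mo_ge => V oV; exact: lam_mono.
Qed.

Let mo_ge0 A : 0 <= mo A.
Proof. by apply: mo_ge => U _ _; exact: lam_ge0. Qed.

Let mo_fin A : mo A \is a fin_num.
Proof.
rewrite ge0_fin_numE//; apply: (@le_lt_trans _ _ 1); last by rewrite ltry.
by apply: le_trans (lam_le1 [set: M]); apply: mo_le => //; exact: openT.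
Qed.

Let mo0 : mo set0 = 0.
Proof.
rewrite mo_open; last exact: open0.
apply/eqP; rewrite eq_le lam_ge0 andbT; apply: lam_le => F _.
by rewrite subset0 => ->; rewrite m0.
Qed.

Let mo_mono : {homo mo : A B / A `<=` B >-> A <= B}.
Proof.
by move=> A B AB; apply: mo_ge => U oU BU; apply: mo_le => // x /AB/BU.
Qed.

Let mo_adherent A (e : R) : (0 < e)%R ->
  exists U, [/\ open U, A `<=` U & lam U <= mo A + e%:E].
Proof.
move=> e0; have [_ [U [oU AU] <-] /ltW ?] := lb_ereal_inf_adherent e0 (mo_fin A).
by exists U.
Qed.

Let mo_sigma : sigma_subadditive mo.
Proof.
move=> A; apply/lee_addgt0Pr => e e0.
apply: le_trans (epsilon_trick _ _ (ltW e0)); last by move=> n; exact: mo_ge0.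
have /choice[U HU] : forall n, exists U, [/\ open U, A n `<=` U &
    lam U <= mo (A n) + (e / (2 ^ n.+1)%:R)%:E].
  by move=> n; apply: mo_adherent; rewrite divr_gt0// ltr0n expn_gt0.
apply: (@le_trans _ _ (lam (\bigcup_n U n))).
  apply: mo_le; first by apply: bigcup_open => i _; have [] := HU i.
  by move=> x [i _ Aix]; exists i => //; have [_ + _] := HU i; exact.
apply: le_trans (lam_sigma _) _; first by move=> i; have [] := HU i.
by apply: lee_nneseries => [i _ _|i _]; [exact: lam_ge0|have [] := HU i].
Qed.

HB.instance Definition _ := isOuterMeasure.Build R M content_outer
  mo0 mo_ge0 mo_mono mo_sigma.

(** A closed subset [F] of [V `&` U] and a closed subset of [V `\` F] are
    disjoint, so their contents add up inside [V]. *)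
Let open_caratheodory U : open U -> mo.-caratheodory U.
Proof.
move=> oU; apply: le_caratheodory_measurable => X; apply: mo_ge => V oV XV.
apply: (@le_trans _ _ (lam (V `&` U) + mo (V `&` ~` U))).
  apply: leeD; last by apply: mo_mono; exact: setSI.
  by apply: mo_le; [exact: openI|exact: setSI].
rewrite -leeBrDr ?mo_fin//; apply: lam_le => F cF FVU.
rewrite leeBrDr ?mo_fin// addeC -leeBrDr//.
have oVF : open (V `&` ~` F) by apply: openI => //; exact: closed_openC.
apply: (@le_trans _ _ (lam (V `&` ~` F))).
  apply: mo_le => // x [Vx nUx]; split => // Fx; apply: nUx.
  by have [] := FVU x Fx.
apply: lam_le => G cG GVF; rewrite leeBrDr// -EFinD -m_add//.
  by apply: lam_ub; [exact: closedU|move=> x [/GVF[]|/FVU[]]].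
by apply/disj_setPS => x [/GVF[_ ?] ?].
Qed.

Let borel_caratheodory :
  @measurable _ (g_sigma_algebraType (@open M)) `<=` mo.-caratheodory.
Proof.
apply: smallest_sub; last by move=> U; exact: open_caratheodory.
split => //= [|A cA|A cA].
- exact: caratheodory_measurable_set0.
- by rewrite setTD; exact: caratheodory_measurable_setC.
- exact: caratheodory_measurable_bigcup.
Qed.

Let mo_additive :
  semi_sigma_additive (mo : set (g_sigma_algebraType (@open M)) -> \bar R).
Proof.
move=> F mF tF mUF.
apply: (@caratheodory_measure_sigma_additive R M content_outer) => //.
- by move=> i; exact: (borel_caratheodory (mF i)).
- exact: borel_caratheodory.
Qed.

Let moT : mo [set: M] = 1.
Proof.
rewrite mo_open; last exact: openT.
apply/eqP; rewrite eq_le lam_le1/= -mT; exact: lam_ub.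
Qed.

(** Outer regularity of [nu] at closed sets, stated so that limits of measures
    of closed sets can be compared with [nu]. *)
Lemma closed_content_prob : exists nu : borelProb R M,
  forall F, closed F -> forall e : R, (0 < e)%R ->
  exists U, [/\ open U, F `<=` U &
    forall G, closed G -> G `<=` U -> (m G <= fine (nu F) + e)%R].
Proof.
pose mP := isMeasure.Build _ (g_sigma_algebraType (@open M)) R
  content_outer mo0 mo_ge0 mo_additive.
pose mm : {measure set (g_sigma_algebraType (@open M)) -> \bar R} :=
  HB.pack content_outer mP.
pose nu : borelProb R M := HB.pack content_outer mP
  (Measure_isProbability.Build _ _ R mm moT).
exists nu => F cF e e0; have [U [oU FU HU]] := mo_adherent F e0.
exists U; split => // G cG GU; rewrite -lee_fin EFinD fineK ?mo_fin//.
by apply: le_trans (lam_ub cG GU) HU.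
Qed.

End ClosedContent.

(** * Portmanteau *)

Section Portmanteau.
Context {R : realType} {M : ptopologicalType}.
Hypothesis cM : compact [set: M].

(** The step functions [d * #{k < n | k * d <= y}] approximate [y] from above
    within [d], as long as [y] stays below [n * d]. *)
Lemma staircase_approx (d y : R) (n : nat) : 0 < d -> 0 <= y ->
  Num.min y (n%:R * d) <= d * \sum_(k < n) (k%:R * d <= y)%R%:R
    <= Num.min (y + d) (n%:R * d).
Proof.
move=> d0 y0; elim: n => [|n /andP[IH1 IH2]].
  rewrite big_ord0 mulr0 mul0r minEle; case: ifPn => h; rewrite ?lexx ?andbT//.
    rewrite h/=; rewrite le_min lexx andbT; lra.
  by rewrite le_min lexx andbT; lra.
rewrite big_ord_recr/= mulrDr; case: (lerP (n%:R * d) y) => h /=.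
  have e : d * \sum_(k < n) (k%:R * d <= y)%R%:R = n%:R * d.
    apply/eqP; rewrite eq_le; apply/andP; split.
      by apply: le_trans IH2 _; rewrite ge_min lexx orbT.
    by apply: le_trans IH1; rewrite le_min lexx andbT.
  rewrite e mulr1 -natr1 mulrDl mul1r ge_min lexx orbT/=.
  by rewrite le_min lerD2r h lexx.
rewrite mulr0 addr0 ge_min le_min; apply/andP; split.
  by apply/orP; left; apply: le_trans IH1; rewrite le_min lexx ltW.
apply/andP; split; first by apply: le_trans IH2 _; rewrite ge_min lexx.
apply: le_trans IH2 _; rewrite ge_min; apply/orP; right.
by rewrite ler_pM2r// ler_nat.
Qed.

Lemma int_sum_indic (mu : borelProb R M) (n : nat) (F : nat -> set M) :
  (forall k, closed (F k)) ->
  mu.-integrable setT (EFin \o (fun x => \sum_(k < n) \1_(F k) x : R)) /\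
  \int[mu]_x (\sum_(k < n) \1_(F k) x) = \sum_(k < n) fine (mu (F k)).
Proof.
move=> cF; elim: n => [|n [IH1 IH2]].
  split; first by under eq_fun do rewrite /= big_ord0; exact: integrable0.
  by under eq_Rintegral do rewrite big_ord0; rewrite big_ord0 int_cst.
have Ik : mu.-integrable setT (EFin \o (\1_(F n) : M -> R)).
  by apply: integrable_indic; exact: closed_borel.
split.
  under eq_fun do rewrite /= big_ord_recr/=.
  exact: (integrable_addr IH1 Ik).
under eq_Rintegral do rewrite big_ord_recr/=.
rewrite RintegralD// IH2 big_ord_recr/=; congr (_ + _).
by rewrite /Rintegral integral_indic ?setIT//; exact: closed_borel.
Qed.

(** It suffices that closed sets have no less mass in the limit: a continuous
    function is uniformly close to a staircase built on its superlevel sets. *)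
Lemma portmanteau (I : Type) (F : set_system I) {FF : Filter F}
    (mu : I -> borelProb R M) (nu : borelProb R M) :
  (forall G, closed G -> forall e : R, 0 < e ->
     \forall i \near F, fine (mu i G) <= fine (nu G) + e) ->
  narrow_cvg F mu nu.
Proof.
move=> muG.
have half (f : M -> R) : continuous f -> forall e, 0 < e ->
    \forall i \near F, \int[mu i]_x f x <= \int[nu]_x f x + e.
  move=> cf e e0; have [B B0 HB] := continuous_bounded cM cf.
  have [d [d0 ed]] : exists d, 0 < d /\ e = d + d.
    by exists (e / 2); rewrite divr_gt0// -splitr.
  pose n := (Num.truncn (2 * B / d)).+1.
  have nd : 2 * B <= n%:R * d.
    by rewrite -ler_pdivrMr// ltW// truncnS_gt.
  pose G k := [set x | k%:R * d <= f x + B].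
  have cG k : closed (G k).
    have cfB : continuous (fun x => f x + B).
      by move=> x; apply: (@cvgD _ R^o); [exact: cf|exact: cvg_cst].
    exact: (preimage_closed (fun x _ => cfB x) (@closed_ge R _)).
  pose S x := d * \sum_(k < n) \1_(G k) x - B.
  have fS x : f x <= S x <= f x + d.
    have := HB x; rewrite ler_norml => /andP[h1 h2].
    have y0 : 0 <= f x + B by lra.
    have := staircase_approx n d0 y0.
    rewrite (_ : \sum_(k < n) _ = \sum_(k < n) \1_(G k) x); last first.
      apply: eq_bigr => k _; rewrite indicE /G; congr (_%:R).
      by congr nat_of_bool; apply/idP/idP => [h|/set_mem//]; apply/mem_set.
    rewrite min_l; last by apply: le_trans nd; lra.
    move=> /andP[h3 h4]; rewrite /S; apply/andP; split; first by lra.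
    by move: h4; rewrite le_min => /andP[h4 _]; lra.
  have Iint (m : borelProb R M) : m.-integrable setT (EFin \o S) /\
      \int[m]_x S x = d * \sum_(k < n) fine (m (G k)) - B.
    have [i1 i2] := int_sum_indic m n cG.
    have i3 := integrable_scaler d i1.
    have i4 (b : R) : m.-integrable setT (EFin \o (fun=> b)).
      exact: finite_measure_integrable_cst.
    split; last by rewrite RintegralB// int_cst RintegralZl// i2.
    exact: (integrable_addr i3 (i4 (- B))).
  have Hn k : \forall i \near F, fine (mu i (G k)) <= fine (nu (G k)) + 1 / n%:R.
    by apply: muG => //; rewrite divr_gt0.
  have Hsum : \forall i \near F,
      \sum_(k < n) fine (mu i (G k)) <= \sum_(k < n) fine (nu (G k)) + 1.
    have := @filter_forall _ 'I_n
      (fun k i => fine (mu i (G k)) <= fine (nu (G k)) + 1 / n%:R) F FF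
      (fun k => Hn k).
    apply: filterS => i Hi.
    rewrite (_ : 1 = \sum_(k < n) (1 / n%:R)); last first.
      by rewrite sumr_const card_ord div1r -(mulr_natl n%:R^-1) divff ?pnatr_eq0.
    by rewrite -big_split/=; apply: ler_sum => k _; exact: Hi.
  apply: filterS Hsum => i Hi.
  have [I1 E1] := Iint (mu i); have [I2 E2] := Iint nu.
  have L1 : \int[mu i]_x f x <= \int[mu i]_x S x.
    by apply: le_Rintegral => //; [exact: continuous_int|move=> x _; case/andP: (fS x)].
  have L2 : \int[nu]_x S x <= \int[nu]_x f x + d.
    rewrite -[X in _ <= _ + X](int_cst nu) -RintegralD//.
    - apply: le_Rintegral => //; last by move=> x _; case/andP: (fS x).
      apply: integrable_addr; first exact: continuous_int.
      exact: finite_measure_integrable_cst.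
    - exact: continuous_int.
    - exact: finite_measure_integrable_cst.
  apply: le_trans L1 _; rewrite E1; rewrite E2 in L2.
  have : d * \sum_(k < n) fine (mu i (G k)) <=
         d * (\sum_(k < n) fine (nu (G k)) + 1) by rewrite ler_pM2l.
  by rewrite mulrDr mulr1 ed => h; lra.
move=> f cf _; apply/cvgrPdist_le => e e0.
have cNf : continuous (fun x => - f x).
  by move=> x; apply: (@cvgN _ R^o); exact: cf.
apply: filterS2 (half f cf e e0) (half _ cNf e e0) => i h1.
have NE (m : borelProb R M) : \int[m]_x (- f x) = - \int[m]_x f x.
  under eq_Rintegral do rewrite -mulN1r.
  by rewrite RintegralZl ?mulN1r//; exact: continuous_int.
by rewrite !NE => h2; rewrite ler_norml; apply/andP; split; lra.
Qed.

End Portmanteau.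

(** * Sequential compactness of probability measures *)

Section NarrowCompactness.
Context {R : realType} {M : ptopologicalType}.
Hypotheses (hM : hausdorff_space M) (cM : compact [set: M]).
Hypothesis scM : @second_countable M.

Lemma ultra_fmap (S T : Type) (f : S -> T) (U : set_system S) :
  UltraFilter U -> UltraFilter (f @ U).
Proof.
move=> UU; split; first exact: fmap_proper_filter.
move=> G GF UG; apply/seteqP; split=> [A GA|A UA]; last exact: UG.
have [//|UnA] := in_ultra_setVsetC (f @^-1` A) UU.
have /filter_ex[t [//]] : G (A `&` ~` A) by apply: filterI => //; exact: UG.
Qed.

Lemma ultra_cvg01 (S : Type) (U : set_system S) (u : S -> R) :
  UltraFilter U -> (forall s, 0 <= u s <= 1) -> exists l : R, u @ U --> l.
Proof.
move=> UU u01; have UuU := ultra_fmap u UU.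
have := @segment_compact R 0 1; rewrite compact_ultra => /(_ _ UuU)[].
  by apply: (@filterE _ U) => s; rewrite /= in_itv/=.
by move=> l [_ ul]; exists l.
Qed.

Lemma basis_enumeration : exists b : nat -> set M,
  (forall k, open (b k)) /\
  forall x U, nbhs x U -> exists k, b k x /\ b k `<=` U.
Proof.
have [BB cBB [oBB bBB]] := scM.
have [b [ob hb]] : exists b : nat -> set M, (forall k, open (b k)) /\
    forall V, BB V -> exists k, b k = V.
  have /pfcard_geP[->|/unsquash f] := cBB.
    by exists (fun=> set0); split => [k|V []]; exact: open0.
  exists f; split => [k|V BV].
    by apply: oBB; apply: (@funS _ _ [set: nat] BB f).
  by have [k _ <-] := @surj _ _ _ _ f V BV; exists k.
exists b; split=> // x U /bBB[V [BV Vx] VU]; have [k bk] := hb V BV.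
by exists k; rewrite bk.
Qed.

(** A closed set inside an open set can be separated from the complement by a
    finite union of basic open sets, and there are countably many of those. *)
Lemma countable_separation : exists B : nat -> set M,
  (forall k, open (B k)) /\
  forall F U, closed F -> open U -> F `<=` U ->
    exists k, F `<=` B k /\ closure (B k) `<=` U.
Proof.
have [b [ob hb]] := basis_enumeration.
pose Bu (s : seq nat) := \bigcup_(i in [set` s]) b i.
exists (fun k => Bu (odflt [::] (unpickle k))); split.
  by move=> k; apply: bigcup_open => i _; exact: ob.
move=> F U cF oU FU.
have /(compact_normal hM cM cF)[V /set_nbhsP[D [oD FD DV]] VU] : set_nbhs F U.
  by apply/set_nbhsP; exists U; split.
pose sn n := [seq i <- iota 0 n | `[< b i `<=` D >]].
have /compact_near_coveringP : compact F by exact: subclosed_compact cF cM _.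
move=> /(_ _ \oo (fun n => Bu (sn n)) _)[].
  move=> x Fx; have [k [bkx bkD]] : exists k, b k x /\ b k `<=` D.
    by apply: hb; apply: open_nbhs_nbhs; split => //; exact: FD.
  exists (b k, [set n | (k < n)%N]).
    split => /=; last exact: nbhs_infty_gt.
    by apply: open_nbhs_nbhs; split; [exact: ob|].
  move=> [x' n] /= [bx' kn]; exists k => //=.
  by rewrite mem_filter mem_iota/= add0n kn andbT; apply/asboolP.
move=> n _ /(_ n (leqnn n)) Fn; exists (pickle (sn n)); rewrite pickleK/=.
split => //; apply: subset_trans VU; apply: closureS.
apply: subset_trans DV => x [i /= + bix].
by rewrite mem_filter => /andP[/asboolP bD _]; exact: bD.
Qed.

(** Take the limit of [P n] on all Borel sets along an ultrafilter: it is only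
    finitely additive, but its inner regularization on open sets extends to a
    measure [nu]. Along a subsequence that realizes this limit on the closures
    of countably many separating open sets, closed sets lose no mass in the limit. *)
Lemma narrow_subsequence (P : nat -> borelProb R M) :
  exists (n_ : nat -> nat) (nu : borelProb R M),
    (forall k, (k <= n_ k)%N) /\ narrow_cvg \oo (P \o n_) nu.
Proof.
have [U [UU oU]] := ultraFilterLemma (eventually_filter : ProperFilter \oo).
have PU : ProperFilter U by exact: ultra_proper.
pose p n (A : set M) : R := fine (P n A).
have pF n A : measurable (A : set (g_sigma_algebraType (@open M))) ->
    P n A \is a fin_num by move=> mA; exact: fin_num_measure.
have p01 n A : closed A -> 0 <= p n A <= 1.
  move=> /closed_borel mA; rewrite /p fine_ge0//=.
  by rewrite -lee_fin fineK ?pF//; exact: probability_le1.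
have pmono n A B : closed A -> closed B -> A `<=` B -> p n A <= p n B.
  move=> /closed_borel mA /closed_borel mB AB; rewrite /p fine_le ?pF//.
  by rewrite le_measure ?inE.
have padd n A B : closed A -> closed B -> [disjoint A & B] ->
    p n (A `|` B) = p n A + p n B.
  move=> /closed_borel mA /closed_borel mB AB.
  by rewrite /p measureU ?fineD ?pF//; apply/eqP.
have psub n A B : closed A -> closed B -> p n (A `|` B) <= p n A + p n B.
  move=> /closed_borel mA /closed_borel mB.
  rewrite /p -fineD ?pF// fine_le ?pF//; first exact: measurableU.
    by rewrite fin_numD !pF.
  exact: measureU2.
have /choice[m mE] : forall A, exists l : R, closed A -> p ^~ A @ U --> l.
  move=> A; have [cA|nA] := pselect (closed A); last by exists 0.
  have [l ul] := ultra_cvg01 UU (fun n => p01 n A cA).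
  by exists l.
have Uq (u : nat -> R) (a b : R) : u @ U --> a -> u @ U --> b -> a = b.
  exact: (cvg_unique (@Rhausdorff R)).
have [nu Hnu] : exists nu : borelProb R M,
    forall F, closed F -> forall e : R, (0 < e)%R ->
    exists V, [/\ open V, F `<=` V &
    forall G, closed G -> G `<=` V -> (m G <= fine (nu F) + e)%R].
  apply: (@closed_content_prob R M hM cM m).
  - have c0 : p ^~ set0 @ U --> m set0 by apply: mE; exact: closed0.
    apply: Uq c0 _; rewrite (_ : p^~ set0 = cst 0); first exact: cvg_cst.
    by apply/funext => n; rewrite /p measure0.
  - have cT : p ^~ setT @ U --> m setT by apply: mE; exact: closedT.
    apply: Uq cT _; rewrite (_ : p^~ setT = cst 1); first exact: cvg_cst.
    by apply/funext => n; rewrite /p (probability_setT (P n)).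
  - move=> F G cF cG FG; apply: ler_cvg_to (mE F cF) (mE G cG) _.
    by apply: filterE => n; exact: pmono.
  - move=> F G cF cG FG; apply: Uq (mE _ (closedU cF cG)) _.
    rewrite (_ : p^~ _ = (fun n => p n F + p n G)).
      by apply: (@cvgD _ R^o); exact: mE.
    by apply/funext => n; exact: padd.
  - move=> F G cF cG; apply: ler_cvg_to (mE _ (closedU cF cG)) _ _.
      by apply: (@cvgD _ R^o); apply: mE.
    by apply: filterE => n; exact: psub.
have [B [oB sepB]] := countable_separation.
have /choice[n_ Hn] : forall j : nat, exists n, (j <= n)%N /\
    forall k : 'I_j, p n (closure (B k)) < m (closure (B k)) + j.+1%:R^-1.
  move=> j.
  have h1 : U [set n | (j <= n)%N] by apply: oU; exact: nbhs_infty_ge.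
  have h2 : \forall n \near U, forall k : 'I_j,
      p n (closure (B k)) < m (closure (B k)) + j.+1%:R^-1.
    apply: filter_forall => k.
    have := mE _ (@closed_closure _ (B k)); move/cvgrPdist_lt.
    have j0 : 0 < j.+1%:R^-1 :> R by rewrite invr_gt0.
    move=> /(_ _ j0); apply: filterS => n /=.
    by rewrite ltr_distl ltrBlDr => /andP[].
  by have [n [? ?]] := filter_ex (filterI h1 h2); exists n.
exists n_, nu; split; first by move=> k; have [] := Hn k.
apply: (portmanteau cM) => F cF e e0; have e20 : 0 < e / 2 by rewrite divr_gt0.
have [V [oV FV HV]] := Hnu F cF _ e20.
have [k [FB BV]] := sepB F V cF oV FV.
near=> j.
have kj : (k < j)%N by near: j; exact: nbhs_infty_gt.
have ej : j.+1%:R^-1 < e / 2.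
  by near: j; exact: near_infty_natSinv_lt (PosNum e20).
have [_ /(_ (Ordinal kj))/= h1] := Hn j.
have h2 := HV _ (@closed_closure _ _) BV.
have h3 : p (n_ j) F <= p (n_ j) (closure (B k)).
  apply: pmono => //; first exact: closed_closure.
  by apply: subset_trans FB _; exact: subset_closure.
rewrite /p/= in h1 h3 *; move: h1 h2 h3 ej; clear.
set a := fine _; set b := fine _; set c := fine _; set i := _^-1; lra.
Unshelve. all: by end_near. Qed.

End NarrowCompactness.

(** * Directional derivatives and the chain rule *)

Section FiniteLimits.
Context {R : realType} {I : finType} {T : Type} (F : set_system T).
Context {FF : Filter F} (u : I -> T -> R) (l : I -> R).
Hypothesis ul : forall k, u k @ F --> l k.

Lemma cvg_sum_fin : (fun t => \sum_k u k t) @ F --> \sum_k l k.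
Proof.
by apply: (@cvg_big R^o I +%R 0 xpredT (@add_continuous R^o) T F _ u l FF).
Qed.

Lemma cvg_prod_fin : (fun t => \prod_k u k t) @ F --> \prod_k l k.
Proof.
by apply: (@cvg_big R^o I *%R 1 xpredT (@mul_continuous R) T F _ u l FF).
Qed.

End FiniteLimits.

Section DirectionalDerivatives.
Context {R : realType}.

(** Derivatives along a line are derivatives of functions of one variable; in
    this form the one-dimensional mean value theorem applies. *)
Lemma is_derive_line (V W : normedModType R) (f : V -> W) (p v : V) (s : R)
    (d : W) :
  is_derive (p + s *: v) v f d <-> is_derive s 1 (fun r : R => f (p + r *: v)) d.
Proof.
have E : (fun h : R => h^-1 *: ((f \o shift (p + s *: v)) (h *: v) -
    f (p + s *: v))) = (fun h : R => h^-1 *: (((fun r : R => f (p + r *: v))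
    \o shift s) (h *: 1) - f (p + s *: v))).
  apply/funext => h /=; congr (_ *: (f _ - _)).
  by rewrite addrCA -scalerDl [h *: 1]mulr1.
by split=> -[h1 h2]; split; rewrite /derivable/derive ?E// -E.
Qed.

Lemma is_derive_near (V W : normedModType R) (f : V -> W) (p v : V) (d : W) :
  is_derive p v f d <->
  (fun h : R => h^-1 *: (f (h *: v + p) - f p)) @ 0^' --> d.
Proof.
split=> [[h <-]|h]; first exact: h.
by split; [apply/cvg_ex; exists d|apply: (cvg_lim (@norm_hausdorff _ _) h)].
Qed.

Context {V : normedModType R}.
Implicit Types (f : V -> R^o) (p u v : V).

Lemma mean_value f p v :
  (forall s : R, 0 <= s <= 1 -> derivable f (p + s *: v) v) ->
  exists2 s : R, 0 < s < 1 & f (p + v) - f p = 'D_v f (p + s *: v).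
Proof.
move=> dv; pose g (s : R) : R := f (p + s *: v).
have dg (s : R) : 0 <= s <= 1 -> is_derive s 1 g ('D_v f (p + s *: v)).
  move=> s01; exact: (iffLR (@is_derive_line V R^o f p v s _)
    (derivableP (dv s s01))).
have [||s] := @MVT R g (fun s => 'D_v f (p + s *: v)) 0 1 ltr01.
- move=> s; rewrite in_itv/= => /andP[/ltW s0 /ltW s1].
  by apply: dg; rewrite s0 s1.
- apply: derivable_within_continuous => s; rewrite in_itv/= => s01.
  by have [] := dg s s01.
- rewrite in_itv/= => s01 E; exists s => //; move: E.
  by rewrite /g scale1r scale0r addr0 subr0 mulr1.
Qed.

Lemma is_deriveZ_dir f p v (a d : R) :
  is_derive p v f d -> is_derive p (a *: v) f (a * d).
Proof.
have [->|a0] := eqVneq a 0.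
  rewrite mul0r scale0r => _; apply/is_derive_near.
  under eq_fun do rewrite scaler0 add0r subrr scaler0.
  exact: cvg_cst.
move=> /is_derive_near H; apply/is_derive_near.
have aN : (fun h : R => h * a) @ 0^' --> (0 : R)^'.
  move=> A [e /= e0 He]; exists (e / `|a|); first by rewrite /= divr_gt0// normr_gt0.
  move=> h /=; rewrite sub0r normrN ltr_pdivlMr ?normr_gt0// => he h0.
  by apply: He; [rewrite /= sub0r normrN normrM|rewrite mulf_neq0].
have K : (fun h : R => a * ((h * a)^-1 *: (f ((h * a) *: v + p) - f p))) @ 0^'
    --> a * d.
  by apply: cvgM; [exact: cvg_cst|exact: (cvg_comp _ _ aN H)].
apply: cvg_trans K.
apply: near_eq_cvg; near=> h => /=.
have h0 : h != 0 by near: h; exact: nbhs_dnbhs_neq.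
by rewrite scalerA [h^-1 *: _]/(h^-1 * _) [_ *: (f _ - _)]/(_ * _) mulrA invfM
  mulrCA divff// mulr1.
Unshelve. all: by end_near. Qed.

(** Walk from [p] along [h v], then along [h u]; the mean value theorem on the
    second leg and continuity of ['D_u f] give the sum of the two rates. *)
Lemma is_deriveD_dir f p u v :
  (\forall q \near p, derivable f q u) -> {for p, continuous ('D_u f)} ->
  derivable f p v -> is_derive p (u + v) f ('D_u f p + 'D_v f p).
Proof.
move=> nu cu dv; apply/is_derive_near.
have dv' : (fun h : R => h^-1 *: (f (h *: v + p) - f p)) @ 0^' --> 'D_v f p.
  by apply/is_derive_near; exact: derivableP.
suff du : (fun h : R => h^-1 *: (f (h *: (u + v) + p) - f (h *: v + p))) @ 0^'
    --> 'D_u f p.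
  apply: cvg_trans (cvgD du dv'); apply: near_eq_cvg.
  by apply: nearW => h; rewrite !fctE -scalerDr subrKA.
apply/cvgrPdist_lt => e e0.
have /nbhs_ballP[r /= r0 Hr] : nbhs p ([set q | derivable f q u] `&`
    [set q | `|'D_u f p - 'D_u f q| < e]).
  by apply: filterI => //; move/cvgrPdist_lt : cu; exact.
pose N := `|u| + `|v| + 1.
have N0 : 0 < N by rewrite /N ltr_wpDl// addr_ge0.
near=> h.
have h0 : h != 0 by near: h; exact: nbhs_dnbhs_neq.
have hr : `|h| < r / N by near: h; apply: dnbhs0_lt; rewrite divr_gt0.
have inb (s : R) : 0 <= s <= 1 -> ball p r ((h *: v + p) + s *: (h *: u)).
  move=> /andP[s0 s1]; rewrite -ball_normE /ball_/= distrC.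
  rewrite (_ : _ - p = h *: v + s *: (h *: u)); last by rewrite addrAC addrK.
  apply: le_lt_trans (ler_normD _ _) _; rewrite !normrZ (ger0_norm s0).
  apply: (@le_lt_trans _ _ (`|h| * (`|u| + `|v|))).
    by rewrite mulrDr addrC lerD2r ler_piMl// mulr_ge0.
  apply: (@le_lt_trans _ _ (`|h| * N)).
    by rewrite ler_wpM2l// /N lerDl.
  by rewrite -ltr_pdivlMr.
have [s /andP[s0 s1] E] := @mean_value f (h *: v + p) (h *: u) (fun s s01 =>
  ex_derive (is_derive := is_deriveZ_dir h (derivableP (Hr _ (inb s s01)).1))).
have -> : h *: (u + v) + p = (h *: v + p) + h *: u.
  by rewrite scalerDr -addrA addrC.
rewrite E.
have [_ q2] := Hr _ (inb s (introT andP (conj (ltW s0) (ltW s1)))).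
have dq : derivable f (h *: v + p + s *: (h *: u)) u.
  by have [] := Hr _ (inb s (introT andP (conj (ltW s0) (ltW s1)))).
have := is_deriveZ_dir h (derivableP dq) => -[_ ->].
by rewrite [_ *: _]mulKf.
Unshelve. all: by end_near. Qed.

End DirectionalDerivatives.

Section C1Functions.
Context {R : realType} {d : nat}.
Local Notation E := 'rV[R]_d.
Variables (U : set E) (f : E -> R^o).
Hypotheses (oU : open U) (cf : Ck_on 1 U f).

Lemma C1_continuous p : U p -> {for p, continuous f}.
Proof. by have [h _] := cf; exact: h. Qed.

Lemma C1_derivable p v : U p -> derivable f p v.
Proof. by have [_ /(_ v)[h _]] := cf; exact: h. Qed.

Lemma C1_derive_continuous p v : U p -> {for p, continuous ('D_v f)}.
Proof. by have [_ /(_ v)[_ [h _]]] := cf; exact: h. Qed.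

Lemma C1_derive_linear p v : U p ->
  'D_v f p = \sum_k v 0 k * 'D_(delta_mx 0 k) f p.
Proof.
move=> Up.
have D0 : 'D_0 f p = 0 :> R by rewrite derive0.
have DD u w : 'D_(u + w) f p = 'D_u f p + 'D_w f p.
  have [] // := @is_deriveD_dir R _ f p u w.
  - by apply: filterS (open_nbhs_nbhs (conj oU Up)) => q; exact: C1_derivable.
  - exact: C1_derive_continuous.
  - exact: C1_derivable.
have DZ a w : 'D_(a *: w) f p = a * 'D_w f p.
  by have [] := is_deriveZ_dir a (derivableP (@C1_derivable p w Up)).
rewrite {1}(row_sum_delta v).
rewrite (big_morph (fun w => 'D_w f p) DD D0).
by apply: eq_bigr => k _; rewrite DZ.
Qed.

(** Mean value theorem on the segment from [c t] to [c (t + h)]: the increment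
    of [f] is the derivative of [f] at an intermediate point, applied to the
    increment of [c]. *)
Lemma C1_chain_curve (c : R -> E) (t : R) (w : E) :
  U (c t) -> is_derive t 1 c w -> is_derive t 1 (f \o c) ('D_w f (c t)).
Proof.
move=> Uct cw; apply/is_derive_near.
have dc : (fun h : R => h^-1 *: (c (h *: 1 + t) - c t)) @ 0^' --> w.
  by apply/is_derive_near.
have id0 : (fun h : R => h) @ 0^' --> (0 : R) by exact: cvg_within.
have inc0 : (fun h : R => c (h *: 1 + t) - c t) @ 0^' --> (0 : E).
  rewrite -(scale0r w); apply: cvg_trans (cvgZ id0 dc).
  apply: near_eq_cvg; near=> h => /=; rewrite scalerA divff ?scale1r//.
  by near: h; exact: nbhs_dnbhs_neq.
have /nbhs_ballP[r /= r0 Hr] : nbhs (c t) U by exact: open_nbhs_nbhs.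
have /choice[xi Hxi] : forall h : R, exists xi : E,
    `|c (h *: 1 + t) - c t| < r ->
    [/\ `|c t - xi| <= `|c (h *: 1 + t) - c t|, U xi &
    f (c (h *: 1 + t)) - f (c t) = 'D_(c (h *: 1 + t) - c t) f xi].
  move=> h; have [hr|] := pselect (`|c (h *: 1 + t) - c t| < r); last by exists 0.
  have inb (s : R) : 0 <= s <= 1 ->
      `|c t - (c t + s *: (c (h *: 1 + t) - c t))| <= `|c (h *: 1 + t) - c t|.
    move=> /andP[s0 s1]; rewrite opprD addrA subrr sub0r normrN normrZ ger0_norm//.
    by rewrite ler_piMl.
  have inU (s : R) : 0 <= s <= 1 -> U (c t + s *: (c (h *: 1 + t) - c t)).
    by move=> s01; apply: Hr; rewrite -ball_normE /ball_/= (le_lt_trans (inb s s01)).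
  have [s /andP[/ltW s0 /ltW s1] Es] := @mean_value R _ f (c t)
    (c (h *: 1 + t) - c t) (fun s s01 => @C1_derivable _ _ (inU s s01)).
  exists (c t + s *: (c (h *: 1 + t) - c t)) => _; split.
  - by apply: inb; rewrite s0 s1.
  - by apply: inU; rewrite s0 s1.
  - by rewrite -Es [c t + (_ - c t)]addrC subrK.
have incr : \forall h \near (0 : R)^', `|c (h *: 1 + t) - c t| < r.
  by move/cvgr0_norm_lt : inc0; exact.
have xic : xi @ 0^' --> c t.
  apply/cvgrPdist_lt => e e0; near=> h.
  have [|+ _ _] := Hxi h; first by near: h.
  move=> /le_lt_trans; apply; near: h.
  by move/cvgr0_norm_lt : inc0; exact.
have Dxi k : (fun h => 'D_(delta_mx 0 k) f (xi h)) @ 0^' -->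
    'D_(delta_mx 0 k) f (c t).
  apply: (cvg_comp xi ('D_(delta_mx 0 k) f) xic).
  exact: C1_derive_continuous.
rewrite (C1_derive_linear w Uct).
have K : (fun h : R => \sum_k (h^-1 *: (c (h *: 1 + t) - c t)) 0 k *
    'D_(delta_mx 0 k) f (xi h)) @ 0^' --> \sum_k w 0 k * 'D_(delta_mx 0 k) f (c t).
  apply: cvg_sum_fin => k.
  apply: cvgM; last exact: Dxi.
  exact: (cvg_comp _ _ dc (@coord_continuous _ _ _ 0 k w)).
apply: cvg_trans K; apply: near_eq_cvg; near=> h.
have [|_ Uxi ->] := Hxi h; first by near: h.
rewrite (C1_derive_linear _ Uxi) scaler_sumr; apply: eq_bigr => k _.
by rewrite mxE -mulrA.
Unshelve. all: by end_near. Qed.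

Lemma C1_chain (V : normedModType R) (tau : V -> E) (p v : V) :
  U (tau p) -> derivable tau p v ->
  is_derive p v (f \o tau) ('D_('D_v tau p) f (tau p)).
Proof.
move=> Up dt; pose c (r : R) := tau (p + r *: v).
have p0 : p + (0 : R) *: v = p by rewrite scale0r addr0.
have c0 : c 0 = tau p by rewrite /c p0.
have cD : is_derive (0 : R) 1 c ('D_v tau p).
  apply: (iffLR (@is_derive_line _ _ _ tau p v 0 _)); rewrite p0.
  exact: derivableP.
have Uc : U (c 0) by rewrite c0.
have H := iffRL (@is_derive_line _ _ _ (f \o tau) p v 0 _) (C1_chain_curve Uc cD).
by rewrite p0 c0 in H.
Qed.

End C1Functions.

(** * Inner products and the Riesz isomorphism *)

Section InverseMatrixLimits.
Context {R : realType} {T : Type} (F : set_system T) {FF : Filter F}.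

Lemma cvg_det n (A : T -> 'M[R]_n) (B : 'M[R]_n) :
  (forall i j, (fun t => A t i j) @ F --> (B i j : R)) ->
  (fun t => \det (A t)) @ F --> (\det B : R).
Proof.
move=> AB; rewrite /determinant; apply: cvg_sum_fin => s.
by apply: cvgM; [exact: cvg_cst|apply: cvg_prod_fin => i; exact: AB].
Qed.

(** Cramer's rule expresses the entries of the inverse by determinants. *)
Lemma cvg_invmx n (A : T -> 'M[R]_n) (B : 'M[R]_n) :
  (forall i j, (fun t => A t i j) @ F --> (B i j : R)) ->
  B \in unitmx -> (\forall t \near F, A t \in unitmx) ->
  forall i j, (fun t => invmx (A t) i j) @ F --> (invmx B i j : R).
Proof.
move=> AB uB uA i j.
have dB : \det B != 0 by rewrite -unitfE -unitmxE.
have K : (fun t => (\det (A t))^-1 * cofactor (A t) j i) @ F -->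
    ((\det B)^-1 * cofactor B j i : R).
  apply: cvgM; first by apply: cvgV => //; exact: cvg_det.
  rewrite /cofactor; apply: cvgM; first exact: cvg_cst.
  apply: cvg_det => k l; rewrite !mxE.
  by under eq_fun do rewrite !mxE; exact: AB.
have iE C : C \in unitmx -> invmx C i j = (\det C)^-1 * cofactor C j i.
  by move=> uC; rewrite /invmx uC !mxE.
rewrite iE//; apply: cvg_trans K; apply: near_eq_cvg.
by apply: filterS uA => t ut; rewrite iE.
Qed.

End InverseMatrixLimits.

Section InnerProduct.
Context {R : realType} {d : nat} (G : 'M[R]_d).
Hypotheses (Gsym : G^T = G) (Gpos : forall y : 'rV[R]_d, y != 0 -> 0 < bilin G y y).
Implicit Types y z xi : 'rV[R]_d.

Lemma posdef_unitmx : G \in unitmx.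
Proof.
rewrite -row_free_unit -kermx_eq0; apply/rowV0P => v /sub_kermxP vG.
by apply/eqP; apply: contraT => /Gpos; rewrite /bilin vG mul0mx mxE ltxx.
Qed.

Lemma pairingE xi y : pairing xi y = (xi *m y^T) 0 0.
Proof. by rewrite mxE; apply: eq_bigr => k _; rewrite !mxE. Qed.

Let bilinC y z : bilin G y z = bilin G z y.
Proof.
have -> : bilin G y z = (y *m G *m z^T)^T 0 0 by rewrite [RHS]mxE.
by rewrite !trmx_mul trmxK Gsym mulmxA.
Qed.

Let bilinZ a y z : bilin G (a *: y) z = a * bilin G y z.
Proof. by rewrite /bilin -!scalemxAl mxE. Qed.

Let bilinB y z : bilin G (y - z) (y - z) =
  bilin G y y - 2 * bilin G z y + bilin G z z.
Proof.
have Bl a b c : bilin G (a - b) c = bilin G a c - bilin G b c.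
  by rewrite /bilin !mulmxBl mxE [X in _ + X]mxE.
by rewrite Bl ![bilin G _ (y - z)]bilinC !Bl (bilinC z y) (bilinC y z); ring.
Qed.

Let bilin_ge0 y : 0 <= bilin G y y.
Proof.
have [->|/Gpos/ltW//] := eqVneq y 0.
by rewrite /bilin mul0mx mul0mx mxE.
Qed.

Local Notation N y := (Num.sqrt (bilin G y y)).

(** With [u] the unit vector along [xi G^-1], the pairing with [xi] is a
    positive multiple of the inner product with [u], and expanding
    [|z - u|^2 >= 0] both bounds that inner product on the unit ball and
    shows that [u] is the only maximizer on the unit sphere. *)
Lemma riesz_formula xi :
  sup [set pairing xi y | y in [set y | N y <= 1]] *:
    xget 0 [set y | N y = 1 /\
                    forall z, N z = 1 -> pairing xi z <= pairing xi y]
  = xi *m invmx G.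
Proof.
have uG := posdef_unitmx.
have N0 : N 0 = 0.
  by rewrite /bilin mul0mx mul0mx mxE sqrtr0.
have [->|xi0] := eqVneq xi 0.
  have p0 z : pairing 0 z = 0 :> R by rewrite pairingE mul0mx mxE.
  rewrite (_ : [set pairing _ _ | _ in _] = [set 0]) ?sup1 ?scale0r ?mul0mx//.
  apply/seteqP; split=> [_ [y _ <-]|_ ->]; first by rewrite /= p0.
  by exists 0; rewrite /= ?N0.
pose y0 := xi *m invmx G.
have y0n0 : y0 != 0.
  apply: contraNneq xi0 => y00.
  by rewrite -[xi](mulmxKV uG) -/y0 y00 mul0mx.
have pE z : pairing xi z = bilin G y0 z.
  by rewrite pairingE /bilin /y0 mulmxKV.
pose n := N y0.
have n0 : 0 < n by rewrite sqrtr_gt0 Gpos.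
have nn : bilin G y0 y0 = n * n by rewrite -expr2 sqr_sqrtr.
pose u := n^-1 *: y0.
have bu z : bilin G u z = n^-1 * bilin G y0 z by rewrite bilinZ.
have buu : bilin G u u = 1.
  rewrite bu bilinC bilinZ nn mulrA -invfM mulVf//.
  by rewrite mulf_neq0// gt_eqF.
have Nu : N u = 1 by rewrite buu sqrtr1.
have pu z : pairing xi z = n * bilin G u z.
  by rewrite bu mulrA divff ?mul1r ?pE// gt_eqF.
have key z : N z <= 1 -> pairing xi z <= n.
  move=> Nz; have zz : bilin G z z <= 1.
    rewrite -[bilin G z z]sqr_sqrtr// expr_le1//; exact: sqrtr_ge0.
  rewrite pu -[leRHS]mulr1 ler_pM2l//.
  have := bilin_ge0 (z - u); rewrite bilinB buu; lra.
have xin : pairing xi u = n by rewrite pu buu mulr1.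
have -> : sup [set pairing xi y | y in [set y | N y <= 1]] = n.
  apply/eqP; rewrite eq_le; apply/andP; split.
    apply: ge_sup => [|_ [z Nz <-]]; last exact: key.
    by exists n; exists u; rewrite /= ?Nu.
  apply: ub_le_sup; last by exists u; rewrite /= ?Nu.
  by exists n => _ [z Nz <-]; exact: key.
case: xgetP => [y _ [Ny ymax]|/(_ u)]; last first.
  by case; split => // z Nz; rewrite xin key// Nz.
suff -> : y = u by rewrite /u scalerA divff ?scale1r// gt_eqF.
apply/eqP; rewrite -subr_eq0; apply: contraT => /Gpos; rewrite bilinB buu.
have yy : bilin G y y = 1 by rewrite -[LHS]sqr_sqrtr// Ny expr1n.
have := ymax u Nu; rewrite xin pu -[X in X <= _]mulr1 ler_pM2l// yy.
by move=> h1 h2; exfalso; lra.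
Qed.

End InnerProduct.

(** * Gradients in charts *)

Section Charts.
Context {R : realType} {d : nat} {M : ptopologicalType}.
Variable A : smoothManifold R d M.
Implicit Types (i j : atlas A) (x : M) (f : M -> R).

Lemma chart_mem i x : chart_dom i x -> chart_img i (chart i x).
Proof. by move=> ix; exists x. Qed.

Lemma chart_nbhs i x : chart_dom i x -> nbhs x (chart_dom i).
Proof. by move=> ix; apply: open_nbhs_nbhs; split => //; exact: chart_dom_open. Qed.

Lemma chart_img_nbhs i p : chart_img i p -> nbhs p (chart_img i).
Proof. by move=> ip; apply: open_nbhs_nbhs; split => //; exact: chart_img_open. Qed.

Lemma chart_cvg i x : chart_dom i x -> {for x, continuous (chart i)}.
Proof.
move=> ix; have := @chart_continuous _ _ _ A i.
rewrite continuous_open_subspace; last exact: chart_dom_open.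
by apply; rewrite inE.
Qed.

Lemma chart_inv_cvg i p : chart_img i p -> {for p, continuous (chart_inv i)}.
Proof.
move=> ip; have := @chart_inv_continuous _ _ _ A i.
rewrite continuous_open_subspace; last exact: chart_img_open.
by apply; rewrite inE.
Qed.

Definition C1_manifold f : Prop :=
  forall i, Ck_on 1 (chart_img i) (f \o chart_inv i : 'rV[R]_d -> R^o).

Definition chart_grad i f x : 'rV[R]_d :=
  \row_k 'D_(delta_mx 0 k) (f \o chart_inv i : 'rV[R]_d -> R^o) (chart i x).

Lemma chart_comp_cvg (T : topologicalType) i x (h : 'rV[R]_d -> T) :
  chart_dom i x -> {for chart i x, continuous h} ->
  {for x, continuous (h \o chart i)}.
Proof.
by move=> ix ch; apply: continuous_comp; [exact: chart_cvg|exact: ch].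
Qed.

Lemma C1_manifold_continuous f : C1_manifold f -> continuous f.
Proof.
move=> cf x; pose i := chart_at A x; have ix := chart_at_dom A x.
have c1 := chart_comp_cvg ix (C1_continuous (cf i) (chart_mem ix)).
suff : f @ nbhs x --> (f \o chart_inv i \o chart i) x by rewrite /= chartK.
apply: (cvg_trans _ c1).
apply: near_eq_cvg; apply: filterS (chart_nbhs ix) => x' ix'.
by rewrite /= chartK.
Qed.

Lemma chart_grad_continuous f i x k : C1_manifold f -> chart_dom i x ->
  {for x, continuous (fun x => chart_grad i f x 0 k)}.
Proof.
move=> cf ix; rewrite (_ : (fun x => _) = 'D_(delta_mx 0 k)
  (f \o chart_inv i : 'rV[R]_d -> R^o) \o chart i); last first.
  by apply/funext => x'; rewrite mxE.
exact: (chart_comp_cvg ix (@C1_derive_continuous _ _ _ _ (cf i) _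
  (delta_mx 0 k) (chart_mem ix))).
Qed.

Definition transition_jacobian i j x : 'M[R]_d :=
  \matrix_k 'D_(delta_mx 0 k) (chart j \o chart_inv i) (chart i x).

(** Chain rule for [f] in chart [j] composed with the transition map. *)
Lemma chart_grad_change f i j x : C1_manifold f ->
  chart_dom i x -> chart_dom j x ->
  chart_grad i f x = chart_grad j f x *m (transition_jacobian i j x)^T.
Proof.
move=> cf ix jx; apply/rowP => k; rewrite !mxE.
have pE : (chart j \o chart_inv i) (chart i x) = chart j x by rewrite /= chartK.
have dt : derivable (chart j \o chart_inv i) (chart i x) (delta_mx 0 k).
  have [_ /(_ (delta_mx 0 k))[h _]] := @transition_smooth _ _ _ A i j 1.
  by apply: h; exists x.
have Uj : chart_img j ((chart j \o chart_inv i) (chart i x)).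
  by rewrite pE; exact: chart_mem.
have [_ ->] : is_derive (chart i x) (delta_mx 0 k)
    (f \o chart_inv i : 'rV[R]_d -> R^o)
    ('D_('D_(delta_mx 0 k) (chart j \o chart_inv i) (chart i x))
      (f \o chart_inv j : 'rV[R]_d -> R^o) (chart j x)).
  have := C1_chain (@chart_img_open _ _ _ A j) (cf j) Uj dt.
  rewrite pE; apply: near_eq_is_derive.
  have : nbhs (chart i x) (chart_inv i @^-1` chart_dom j).
    apply: (chart_inv_cvg (chart_mem ix)); rewrite chartK//.
    exact: chart_nbhs.
  by apply: filterS => q jq; rewrite /= chartK.
rewrite (C1_derive_linear (@chart_img_open _ _ _ A j) (cf j)); last exact: chart_mem.
by apply: eq_bigr => l _; rewrite !mxE mulrC.
Qed.

Variable g : riemannianMetric A.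

Lemma gram_unit i x : chart_dom i x -> gram g i x \in unitmx.
Proof. by move=> ix; apply: posdef_unitmx => y; exact: gram_pos. Qed.

Lemma gram_change i j x : chart_dom i x -> chart_dom j x ->
  gram g i x = transition_jacobian i j x *m gram g j x *m
    (transition_jacobian i j x)^T.
Proof.
have bE (G : 'M[R]_d) k l : bilin G (delta_mx 0 k) (delta_mx 0 l) = G k l.
  by rewrite /bilin -rowE trmx_delta -colE !mxE.
move=> ix jx; apply/matrixP => k l; rewrite -bE (gram_transition g _ _ ix jx).
set J := transition_jacobian i j x.
rewrite -[in LHS](_ : row k J = 'D_(delta_mx 0 k) (chart j \o chart_inv i) (chart i x)); last by rewrite rowK.
rewrite -[in LHS](_ : row l J = 'D_(delta_mx 0 l) (chart j \o chart_inv i) (chart i x)); last by rewrite rowK.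
rewrite /bilin !rowE trmx_mul trmx_delta !mulmxA -colE mxE.
by rewrite -!mulmxA -rowE !mxE.
Qed.

(** The inner product of the gradients of [f] and [h]. *)
Definition gradprod (f h : M -> R) (x : M) : R :=
  pairing (differential A f x) (J2 g x (differential A h x)).

Definition chart_gradprod i (f h : M -> R) (x : M) : R :=
  (chart_grad i f x *m invmx (gram g i x) *m (chart_grad i h x)^T) 0 0.

Lemma J2E x xi : J2 g x xi = xi *m invmx (gram g (chart_at A x) x).
Proof.
have ix := chart_at_dom A x.
by apply: riesz_formula; [exact: gram_sym|move=> y; exact: gram_pos].
Qed.

(** The Jacobians of the two gradients cancel against those of the metric, so
    any chart around [x] computes the same number. *)
Lemma gradprodE i f h x : C1_manifold f -> C1_manifold h -> chart_dom i x ->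
  gradprod f h x = chart_gradprod i f h x.
Proof.
move=> cf ch ix; pose j := chart_at A x; have jx : chart_dom j x := chart_at_dom A x.
have uj := gram_unit jx; have ui := gram_unit ix.
have E : gradprod f h x = chart_gradprod j f h x.
  rewrite /gradprod J2E pairingE trmx_mul trmx_inv gram_sym// mulmxA.
  by [].
rewrite E /chart_gradprod (chart_grad_change cf ix jx) (chart_grad_change ch ix jx).
move: ui; rewrite (gram_change ix jx).
set J := transition_jacobian i j x; set G := gram g j x.
move=> uX; have /andP[_ uJT] : (J *m G \in unitmx) && (J^T \in unitmx).
  by rewrite -unitmx_mul.
have JJ : J^T *m invmx (J *m G *m J^T) *m J = invmx G.
  rewrite -[LHS](mulmxK uj) -[X in X *m invmx G](mulmxK uJT).
  have : J^T *m (invmx (J *m G *m J^T) *m (J *m G *m J^T)) = J^T.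
    by rewrite mulVmx// mulmx1.
  by rewrite !mulmxA => ->; rewrite mulmxV// mul1mx.
by rewrite -JJ trmx_mul trmxK !mulmxA.
Qed.

Lemma gram_continuous i x k l : chart_dom i x ->
  {for x, continuous (fun x => gram g i x k l)}.
Proof.
move=> ix; have [cG _] := @gram_smooth _ _ _ _ g i 0.
have c1 := chart_comp_cvg ix (cG _ (chart_mem ix)).
have c2 : {for x, continuous (fun x => (gram g i \o chart_inv i \o chart i) x k l)}.
  apply: (@continuous_comp _ _ _ _ (fun N : 'M[R]_d => N k l : R)) => //.
  exact: coord_continuous.
suff : (fun x => gram g i x k l) @ nbhs x -->
    (gram g i \o chart_inv i \o chart i) x k l by rewrite /= chartK.
apply: (cvg_trans _ c2).
apply: near_eq_cvg; apply: filterS (chart_nbhs ix) => x' ix'.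
by rewrite /= chartK.
Qed.

Lemma chart_gradprod_cvg (T : Type) (F : set_system T) {FF : Filter F}
    (u v : T -> M -> R) (u0 v0 : M -> R) (y : T -> M) i x :
  chart_dom i x -> y @ F --> x ->
  (forall k, (fun t => chart_grad i (u t) (y t) 0 k) @ F --> chart_grad i u0 x 0 k) ->
  (forall k, (fun t => chart_grad i (v t) (y t) 0 k) @ F --> chart_grad i v0 x 0 k) ->
  (fun t => chart_gradprod i (u t) (v t) (y t)) @ F --> chart_gradprod i u0 v0 x.
Proof.
move=> ix yx uu0 vv0; rewrite /chart_gradprod !mxE.
under eq_fun do rewrite !mxE.
apply: cvg_sum_fin => l; apply: cvgM; last by rewrite mxE; under eq_fun do rewrite mxE; exact: vv0.
rewrite !mxE; under eq_fun do rewrite !mxE.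
apply: cvg_sum_fin => k; apply: cvgM; first exact: uu0.
apply: cvg_invmx.
- move=> m n.
  exact: (cvg_comp y (fun x => gram g i x m n) yx (@gram_continuous i x m n ix)).
- exact: gram_unit.
- have : F (y @^-1` chart_dom i) := yx _ (chart_nbhs ix).
  by apply: filterS => t; exact: gram_unit.
Qed.

Lemma gradprod_continuous f h : C1_manifold f -> C1_manifold h ->
  continuous (gradprod f h).
Proof.
move=> cf ch x; pose i := chart_at A x; have ix := chart_at_dom A x.
rewrite /continuous_at (gradprodE cf ch ix).
apply: (@cvg_trans _ (chart_gradprod i f h @ nbhs x)).
  apply: near_eq_cvg; apply: filterS (chart_nbhs ix) => x' ix'.
  by rewrite (gradprodE cf ch ix').
apply: (@chart_gradprod_cvg _ (nbhs x) _ (fun=> f) (fun=> h) f h id) => // k;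
  exact: chart_grad_continuous.
Qed.

End Charts.

(** * Integrals of kernels depending on a parameter *)

Section Slices.
Context {R : realType} {V1 V2 W : normedModType R}.

Lemma is_derive_slice1 (F : V1 * V2 -> W) (p v : V1) (q : V2) (d : W) :
  is_derive (p, q) ((v, 0) : V1 * V2) F d -> is_derive p v (fun r => F (r, q)) d.
Proof.
move=> /is_derive_near H; apply/is_derive_near; apply: cvg_trans H.
apply: near_eq_cvg; apply: nearW => h /=; congr (_ *: (F _ - _)).
by congr (_, _); rewrite /= scaler0 add0r.
Qed.

Lemma is_derive_slice2 (F : V1 * V2 -> W) (p : V1) (q v : V2) (d : W) :
  is_derive (p, q) ((0, v) : V1 * V2) F d -> is_derive q v (fun r => F (p, r)) d.
Proof.
move=> /is_derive_near H; apply/is_derive_near; apply: cvg_trans H.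
apply: near_eq_cvg; apply: nearW => h /=; congr (_ *: (F _ - _)).
by congr (_, _); rewrite /= scaler0 add0r.
Qed.

End Slices.

Section Kernels.
Context {R : realType} {M : ptopologicalType}.
Hypothesis cM : compact [set: M].

Lemma swap_cvg (X : topologicalType) (Phi : X * M -> R) (p : X) :
  (forall y, {for (p, y), continuous Phi}) ->
  ccvg (nbhs p) (fun q y => Phi (q, y)) (fun y => Phi (p, y)).
Proof.
move=> cPhi y; apply: (cvg_comp (fun q : M * X => (q.2, q.1)) Phi _ (cPhi y)).
by apply: (@cvg_pair _ _ _ _ (nbhs p) (nbhs y)); [exact: cvg_snd|exact: cvg_fst].
Qed.

Lemma narrow_cst (I : Type) (F : set_system I) {FF : Filter F}
  (mu : borelProb R M) : narrow_cvg F (fun=> mu) mu.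
Proof. by move=> f _ _; exact: cvg_cst. Qed.

Lemma kernel_int_continuous (X : topologicalType) (Phi : X * M -> R) (p : X)
    (mu : borelProb R M) :
  (forall y, {for (p, y), continuous Phi}) ->
  (\forall q \near p, continuous (fun y => Phi (q, y))) ->
  {for p, continuous (fun q => \int[mu]_y Phi (q, y))}.
Proof.
move=> cPhi cPhiq.
apply: (@ccvg_int _ _ cM _ (nbhs p) _ (fun q y => Phi (q, y))
  (fun y => Phi (p, y)) (fun=> mu)) => //; first exact: swap_cvg.
exact: narrow_cst.
Qed.

Lemma slice_continuous (X : topologicalType) (Phi : X * M -> R) (p : X) :
  (forall y, {for (p, y), continuous Phi}) -> continuous (fun y => Phi (p, y)).
Proof. by move=> cPhi; apply: ccvg_continuous (swap_cvg cPhi). Qed.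

(** Differentiation under the integral: the derivatives of the slices are
    bounded near [p] uniformly in [y], by compactness. *)
Lemma is_derive_kernel_int (V : normedModType R) (Phi DPhi : V * M -> R^o)
    (U : set V) (p v : V) (mu : borelProb R M) : open U -> U p ->
  (forall q, U q -> continuous (fun y => Phi (q, y))) ->
  (forall q y, U q -> is_derive q v (fun r => Phi (r, y)) (DPhi (q, y))) ->
  (forall y, {for (p, y), continuous DPhi}) ->
  is_derive p v (fun q => \int[mu]_y Phi (q, y) : R^o) (\int[mu]_y DPhi (p, y)).
Proof.
move=> oU Up cPhi dPhi cD.
have [B B0 HB] := continuous_bounded cM (slice_continuous cD).
have uni := ccvg_uniform cM ltr01 (swap_cvg cD).
have line : (fun s : R => p + s *: v) @ (0 : R) --> p.
  rewrite -[X in _ --> X]addr0 -[X in _ --> _ + X](scale0r v).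
  by apply: cvgD; [exact: cvg_cst|exact: (@scalel_continuous _ _ v 0)].
have nU : nbhs p U by apply: open_nbhs_nbhs; split.
have : nbhs (0 : R) ((fun s : R => p + s *: v) @^-1`
    (U `&` [set q | forall y, `|DPhi (q, y) - DPhi (p, y)| < 1])).
  exact: line _ (filterI nU (uni _)).
move=> /nbhs_ballP[r /= r0 Hr].
have HI (s : R) : (`]-r, r[%classic : set R) s -> U (p + s *: v) /\
    forall y, `|DPhi (p + s *: v, y) - DPhi (p, y)| < 1.
  rewrite /= in_itv/= => sr; apply: Hr.
  by rewrite -ball_normE /ball_/= sub0r normrN ltr_norml.
have I0 : (`]-r, r[%classic : set R) 0 by rewrite /= in_itv/= oppr_lt0 r0.
pose f (s : R) (y : M) := Phi (p + s *: v, y).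
have df (s : R) y : (`]-r, r[%classic : set R) s ->
    is_derive s 1 (f ^~ y : R -> R^o) (DPhi (p + s *: v, y)).
  move=> /HI[Us _].
  exact: (iffLR (@is_derive_line R V R^o (fun q => Phi (q, y)) p v s _) (dPhi _ y Us)).
have If x : (`]-r, r[%classic : set R) x -> mu.-integrable setT (EFin \o f x).
  by move=> /HI[Ux _]; apply: continuous_int => //; exact: cPhi.
have Df x (y : g_sigma_algebraType (@open M)) : (`]-r, r[%classic : set R) x ->
    setT y -> derivable (f ^~ y) x 1.
  by move=> xr _; have [] := df x y xr.
have IB : mu.-integrable setT (EFin \o (cst (B + 1) : M -> R)).
  exact: finite_measure_integrable_cst.
have bD x (y : g_sigma_algebraType (@open M)) : (`]-r, r[%classic : set R) x ->
    setT y -> `|partial1of2 f x y| <= B + 1.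
  move=> xr _; rewrite partial1of2E.
  have [_ ->] := df x y xr; have [_ /(_ y)/ltW h] := HI x xr.
  rewrite -[DPhi _](subrK (DPhi (p, y))) addrC.
  by apply: le_trans (ler_normD _ _) _; apply: lerD.
have B10 (y : g_sigma_algebraType (@open M)) : 0 <= cst (B + 1) y.
  by rewrite /= addr_ge0// ltW.
have d1 := @derivable_under_integral R _ (g_sigma_algebraType (@open M)) mu f setT
  measurableT 0 (-r) r I0 If Df (cst (B + 1)) B10 IB bD.
have d2 := @differentiation_under_integral R _ (g_sigma_algebraType (@open M)) mu f setT
  measurableT 0 (-r) r I0 If Df (cst (B + 1)) B10 IB bD.
have dd : is_derive (0 : R) 1 (fun s : R => \int[mu]_y Phi (p + s *: v, y) : R^o)
    (\int[mu]_y DPhi (p, y)).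
  split; first exact: d1.
  rewrite -derive1E d2; apply: eq_Rintegral => y _.
  by rewrite partial1of2E; have [_ ->] := df 0 y I0; rewrite scale0r addr0.
have := iffRL (@is_derive_line R V R^o (fun q => \int[mu]_y Phi (q, y)) p v 0 _) dd.
by rewrite scale0r addr0.
Qed.

End Kernels.

(** * The potential of a measure *)

Section Potentials.
Context {R : realType} {d : nat} {M : ptopologicalType}.
Context {A : smoothManifold R d M}.
Hypothesis cM : compact [set: M].
Variable W : M * M -> R.
Hypothesis W1 : forall i j : atlas A, Ck_on 1 (chart_img i `*` chart_img j)
  (fun p : 'rV[R]_d * 'rV[R]_d => W (chart_inv i p.1, chart_inv j p.2) : R^o).
Implicit Types (i j : atlas A) (x y : M) (mu nu : borelProb R M).

Local Notation Wc i j := (fun p : 'rV[R]_d * 'rV[R]_d =>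
  W (chart_inv i p.1, chart_inv j p.2) : R^o).

(** [W], and its derivative along [v] in the first variable, read in chart [i]
    on the left only; the second variable stays on the compact manifold, over
    which the kernels are integrated. *)
Let Wi i (z : 'rV[R]_d * M) : R^o := W (chart_inv i z.1, z.2).
Let DWi i (v : 'rV[R]_d) (z : 'rV[R]_d * M) : R^o :=
  'D_((v, 0) : 'rV[R]_d * 'rV[R]_d) (Wc i (chart_at A z.2))
    (z.1, chart (chart_at A z.2) z.2).

Let is_derive_Wi i j v p y : chart_img i p -> chart_dom j y ->
  is_derive p v (fun q => Wi i (q, y))
    ('D_((v, 0) : 'rV[R]_d * 'rV[R]_d) (Wc i j) (p, chart j y)).
Proof.
move=> ip jy; have [_ /(_ (v, 0))[h _]] := W1 i j.
have dW := is_derive_slice1 (derivableP (h (p, chart j y) (conj ip (chart_mem jy)))).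
apply: near_eq_is_derive dW; apply: (@filterE _ (nbhs p)) => q.
by rewrite /Wi/= chartK.
Qed.

Let DWiE i j v p y : chart_img i p -> chart_dom j y ->
  DWi i v (p, y) = 'D_((v, 0) : 'rV[R]_d * 'rV[R]_d) (Wc i j) (p, chart j y).
Proof.
move=> ip jy; have [_ <-] := is_derive_Wi v ip jy; rewrite /DWi/=.
by have [_ <-] := is_derive_Wi v ip (chart_at_dom A y).
Qed.

(** Continuity may be checked after reading the second variable in charts. *)
Let chart_pair_cvg i (U : topologicalType) (F : 'rV[R]_d * M -> U)
    (G : atlas A -> 'rV[R]_d * 'rV[R]_d -> U) p y :
  (forall j q z, chart_img i q -> chart_dom j z -> F (q, z) = G j (q, chart j z)) ->
  (forall j q r, chart_img i q -> chart_img j r -> {for (q, r), continuous (G j)}) ->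
  chart_img i p -> {for (p, y), continuous F}.
Proof.
move=> FG cG ip; pose j := chart_at A y; have jy : chart_dom j y := chart_at_dom A y.
have c1 : (fun z : 'rV[R]_d * M => (z.1, chart j z.2)) @ (p, y) --> (p, chart j y).
  apply: (@cvg_pair _ _ _ _ (nbhs p) (nbhs (chart j y))); first exact: cvg_fst.
  exact: (cvg_comp snd (chart j) cvg_snd (chart_cvg jy)).
rewrite /prop_for/= /continuous_at (FG j)//.
have c2 := cvg_comp _ (G j) c1 (cG j _ _ ip (chart_mem jy)).
apply: cvg_trans c2; apply: near_eq_cvg.
exists (chart_img i, chart_dom j); first by split; [exact: chart_img_nbhs|exact: chart_nbhs].
by move=> [q z] [/= iq jz]; rewrite /= (FG j).
Qed.

Let Wi_continuous i p y : chart_img i p -> {for (p, y), continuous (Wi i)}.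
Proof.
apply: (chart_pair_cvg (G := fun j => Wc i j)).
  by move=> j q z iq jz; rewrite /Wi/= chartK.
by move=> j q r iq jr; have [h _] := W1 i j; exact: (h (q, r)).
Qed.

Let DWi_continuous i v p y : chart_img i p -> {for (p, y), continuous (DWi i v)}.
Proof.
apply: (chart_pair_cvg (G := fun j => 'D_((v, 0) : 'rV[R]_d * 'rV[R]_d) (Wc i j))).
  by move=> j q z iq jz; exact: DWiE.
move=> j q r iq jr; have [_ /(_ (v, 0))[_ [h _]]] := W1 i j.
exact: (h (q, r)).
Qed.

Let chart_fst_cvg i (F : 'rV[R]_d * M -> R) x y : chart_dom i x ->
  {for (chart i x, y), continuous F} ->
  {for (x, y), continuous (fun z : M * M => F (chart i z.1, z.2))}.
Proof.
move=> ix cF.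
apply: (cvg_comp (fun z : M * M => (chart i z.1, z.2)) F _ cF).
apply: (@cvg_pair _ _ _ _ (nbhs (chart i x)) (nbhs y)); last exact: cvg_snd.
exact: (cvg_comp fst (chart i) cvg_fst (chart_cvg ix)).
Qed.

Lemma potential_kernel_continuous : continuous W.
Proof.
move=> [x y]; pose i := chart_at A x; have ix : chart_dom i x := chart_at_dom A x.
have c := chart_fst_cvg ix (@Wi_continuous i _ y (chart_mem ix)).
rewrite /continuous_at.
suff : W @ (x, y) --> (fun z : M * M => Wi i (chart i z.1, z.2)) (x, y).
  by rewrite /Wi/= chartK.
apply: (cvg_trans _ c); apply: near_eq_cvg.
exists (chart_dom i, setT); first by split; [exact: chart_nbhs|exact: filterT].
by move=> [x' y'] [/= ix' _]; rewrite /Wi/= chartK.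
Qed.

Let is_derive_potential i v p mu : chart_img i p ->
  is_derive p v (kernel_avg W mu \o chart_inv i : 'rV[R]_d -> R^o)
    (\int[mu]_y DWi i v (p, y)).
Proof.
move=> ip; apply: (@is_derive_kernel_int R M cM _ (Wi i) (DWi i v) (chart_img i)) => //.
- exact: chart_img_open.
- by move=> q iq; apply: slice_continuous => y; exact: Wi_continuous.
- move=> q y iq; rewrite (DWiE v iq (chart_at_dom A y)).
  by apply: is_derive_Wi => //; exact: chart_at_dom.
- by move=> y; exact: DWi_continuous.
Qed.

Lemma potential_C1 mu : C1_manifold A (kernel_avg W mu).
Proof.
move=> i; split.
  move=> p ip; apply: (kernel_int_continuous cM (Phi := Wi i)).
    by move=> y; exact: Wi_continuous.
  apply: filterS (chart_img_nbhs ip) => q iq.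
  by apply: slice_continuous => y; exact: Wi_continuous.
move=> v; split; first by move=> p ip; have [] := is_derive_potential v mu ip.
split=> // p ip.
have c : {for p, continuous (fun q => \int[mu]_y DWi i v (q, y))}.
  apply: (kernel_int_continuous cM).
    by move=> y; exact: DWi_continuous.
  apply: filterS (chart_img_nbhs ip) => q iq.
  by apply: slice_continuous => y; exact: DWi_continuous.
rewrite /prop_for/= /continuous_at.
have [_ ->] := is_derive_potential v mu ip.
apply: cvg_trans c; apply: (@near_eq_cvg _ _ (nbhs p) _).
apply: filterS (chart_img_nbhs ip) => q iq.
by have [_ ->] := is_derive_potential v mu iq.
Qed.

Section NarrowLimits.
Context {I : Type} (F : set_system I) {FF : ProperFilter F}.
Variables (nu_ : I -> borelProb R M) (nu : borelProb R M).
Hypothesis nu_cvg : narrow_cvg F nu_ nu.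

Lemma potential_grad_cvg i x k : chart_dom i x ->
  (fun z : M * I => chart_grad i (kernel_avg W (nu_ z.2)) z.1 0 k)
    @ filter_prod (nbhs x) F --> chart_grad i (kernel_avg W nu) x 0 k.
Proof.
move=> ix; have gE m x' : chart_dom i x' ->
    chart_grad i (kernel_avg W m) x' 0 k =
    \int[m]_y DWi i (delta_mx 0 k) (chart i x', y).
  by move=> ix'; rewrite mxE; have [_ ->] := is_derive_potential (delta_mx 0 k) m (chart_mem ix').
rewrite gE//.
have c := @kernel_int_cvg R M cM M (fun z => DWi i (delta_mx 0 k) (chart i z.1, z.2))
  x I F FF nu_ nu.
have {}c : (fun z : M * I => \int[nu_ z.2]_y
    DWi i (delta_mx 0 k) (chart i z.1, y)) @ filter_prod (nbhs x) F -->
    \int[nu]_y DWi i (delta_mx 0 k) (chart i x, y).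
  apply: c nu_cvg.
  - by move=> y; exact: (chart_fst_cvg ix (@DWi_continuous i _ _ y (chart_mem ix))).
  - apply: filterS (chart_nbhs ix) => x' ix'; apply: (@slice_continuous _ _ M
      (fun z => DWi i (delta_mx 0 k) (chart i z.1, z.2)) x') => y.
    exact: (chart_fst_cvg ix' (@DWi_continuous i _ _ y (chart_mem ix'))).
apply: cvg_trans c; apply: near_eq_cvg.
exists (chart_dom i, setT).
  by split; [exact: chart_nbhs|exact: filterT].
by move=> [x' t] [/= ix' _]; rewrite gE.
Qed.

End NarrowLimits.
End Potentials.

(** * Dissipation of energy *)

Section Dissipation.
Context {R : realType} {d : nat} {M : ptopologicalType}.
Context {A : smoothManifold R d M} (g : riemannianMetric A).
Hypothesis cM : compact [set: M].
Variables (K W : M * M -> R) (C : R).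
Hypothesis W1 : forall i j : atlas A, Ck_on 1 (chart_img i `*` chart_img j)
  (fun p : 'rV[R]_d * 'rV[R]_d => W (chart_inv i p.1, chart_inv j p.2) : R^o).
Hypotheses (cK : continuous K) (C0 : 0 < C) (KC : forall x y, C <= K (x, y)).
Implicit Types (f : M -> R) (mu nu : borelProb R M).

Let slice2 x : continuous (fun y => K (x, y)).
Proof. by apply: slice_continuous => y; exact: cK. Qed.

Lemma mobility_ge mu x : C <= kernel_avg K mu x.
Proof.
rewrite -[C](int_cst mu); apply: le_Rintegral => //.
- exact: finite_measure_integrable_cst.
- by apply: continuous_int => //; exact: slice2.
Qed.

Let mobility_neq0 mu x : kernel_avg K mu x != 0.
Proof. by rewrite gt_eqF// (lt_le_trans C0)// mobility_ge. Qed.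

Lemma mobility_continuous mu : continuous (kernel_avg K mu).
Proof.
move=> x; apply: (kernel_int_continuous cM (Phi := K)); first by move=> y; exact: cK.
by apply: filterE => x'; exact: slice2.
Qed.

(** The rate at which [f] decays along the velocity field of [mu]. *)
Definition flux f mu x : R :=
  gradprod g f (kernel_avg W mu) x / kernel_avg K mu x.

Lemma pairing_velocity f mu x :
  pairing (differential A f x) (velocity g K W mu x) = - flux f mu x.
Proof.
rewrite /flux /gradprod /velocity !pairingE.
by rewrite linearN/= linearZ/= mulmxN -scalemxAr mxE mxE [in RHS]mulrC.
Qed.

Lemma flux_continuous f mu : C1_manifold A f -> continuous (flux f mu).
Proof.
have cp : C1_manifold A (kernel_avg W mu) := potential_C1 cM W1 mu.
move=> cf x; have c1 := gradprod_continuous (g := g) cf cp (x := x).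
have c2 : (fun x => (kernel_avg K mu x)^-1) @ x --> (kernel_avg K mu x)^-1.
  by apply: cvgV; [exact: mobility_neq0|exact: mobility_continuous].
exact: (cvgM c1 c2).
Qed.

Lemma gradprod_bilin f h x : gradprod g f h x =
  bilin (gram g (chart_at A x) x)
    (differential A f x *m invmx (gram g (chart_at A x) x))
    (differential A h x *m invmx (gram g (chart_at A x) x)).
Proof.
have uG := gram_unit g (chart_at_dom A x).
by rewrite /gradprod J2E pairingE /bilin mulmxKV.
Qed.

Lemma gradprod_ge0 f x : 0 <= gradprod g f f x.
Proof.
rewrite gradprod_bilin; set y := _ *m _.
have [y0|y0] := eqVneq y 0; first by rewrite y0 /bilin mul0mx mul0mx mxE lexx.
by rewrite ltW// gram_pos//; exact: chart_at_dom.
Qed.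

Lemma gradprod_eq0 f h x : gradprod g f f x = 0 -> gradprod g h f x = 0.
Proof.
rewrite !gradprod_bilin; set z := differential A h x *m _; set y := _ *m _.
have [->|y0] := eqVneq y 0; first by move=> _; rewrite /bilin trmx0 mulmx0 mxE.
by move=> e; have := gram_pos g (chart_at_dom A x) y0; rewrite e ltxx.
Qed.

(** For [nu = mu] this is [int |dW[mu]|^2 / m_mu dmu]. Keeping the two arguments
    apart is needed to differentiate the energy, where the potential is frozen
    while the measure moves. *)
Definition slope nu mu : R := \int[mu]_x flux (kernel_avg W nu) mu x.

Lemma slope_ge0 mu : 0 <= slope mu mu.
Proof.
apply: Rintegral_ge0 => x _; rewrite divr_ge0// ?gradprod_ge0//.
by apply: le_trans (ltW C0) _; exact: mobility_ge.
Qed.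

(** If the slope vanishes, then [dW[mu]] does almost everywhere. *)
Lemma slope_eq0 f mu : C1_manifold A f -> slope mu mu = 0 ->
  \int[mu]_x flux f mu x = 0.
Proof.
move=> cf s0.
have c1 : continuous (flux (kernel_avg W mu) mu).
  by apply: flux_continuous; exact: potential_C1.
have f0 x : 0 <= flux (kernel_avg W mu) mu x.
  rewrite divr_ge0// ?gradprod_ge0//.
  by apply: le_trans (ltW C0) _; exact: mobility_ge.
have : (\int[mu]_x `|(flux (kernel_avg W mu) mu x)%:E| = 0)%E.
  under eq_integral => x _ do rewrite gee0_abs ?lee_fin ?f0//.
  have : (\int[mu]_x (flux (kernel_avg W mu) mu x)%:E)%E \is a fin_num.
    by apply: integrable_fin_num => //; exact: continuous_int.
  by move=> /fineK <-; congr _%:E.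
have m1 : measurable_fun [set: g_sigma_algebraType (@open M)]
    (EFin \o flux (kernel_avg W mu) mu).
  by apply/measurable_EFinP; exact: continuous_borel.
move=> /(ae_eq_integral_abs mu measurableT m1) ae0.
have m2 : measurable_fun [set: g_sigma_algebraType (@open M)]
    (EFin \o flux f mu).
  by apply/measurable_EFinP; apply: continuous_borel; exact: flux_continuous.
have h : ae_eq mu setT (EFin \o flux f mu) (cst 0%E).
  apply: filterS ae0 => x h _; have /= := h I => -[].
  move/eqP; rewrite mulf_eq0 invr_eq0 (negbTE (mobility_neq0 mu x)) orbF => /eqP e.
  by rewrite /flux (gradprod_eq0 _ e) mul0r.
have E := ae_eq_integral _ _ measurableT m2 (measurable_cst _) h.
by rewrite /Rintegral [X in fine X]E integral0.
Qed.

(** The gradients converge continuously, hence so do the integrands. *)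
Lemma slope_cvg (I : Type) (F : set_system I) {FF : ProperFilter F}
    (nu_ mu_ : I -> borelProb R M) nu mu :
  narrow_cvg F nu_ nu -> narrow_cvg F mu_ mu ->
  (fun i => slope (nu_ i) (mu_ i)) @ F --> slope nu mu.
Proof.
move=> nuc muc.
apply: (@ccvg_int R M cM I F FF (fun i => flux (kernel_avg W (nu_ i)) (mu_ i))
  (flux (kernel_avg W nu) mu)) => //.
  by apply: filterE => i; apply: flux_continuous; exact: potential_C1.
move=> x; pose i := chart_at A x; have ix : chart_dom i x := chart_at_dom A x.
have c := @chart_gradprod_cvg R d M A g (M * I) (filter_prod (nbhs x) F) _
  (fun z => kernel_avg W (nu_ z.2)) (fun z => kernel_avg W (mu_ z.2))
  (kernel_avg W nu) (kernel_avg W mu) fst i x ix cvg_fst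
  (fun k => potential_grad_cvg cM W1 nuc ix (k := k))
  (fun k => potential_grad_cvg cM W1 muc ix (k := k)).
have c1 : (fun z : M * I => gradprod g (kernel_avg W (nu_ z.2))
      (kernel_avg W (mu_ z.2)) z.1) @ filter_prod (nbhs x) F -->
    gradprod g (kernel_avg W nu) (kernel_avg W mu) x.
  rewrite (gradprodE g _ _ ix); [|exact: potential_C1..].
  apply: cvg_trans (near_eq_cvg _) (c _ _ _ _).
  exists (chart_dom i, setT); first by split; [exact: (chart_nbhs ix)|exact: filterT].
  by move=> [x' t] [/= ix' _]; rewrite (gradprodE g _ _ ix')//; exact: potential_C1.
have c2 : (fun z : M * I => kernel_avg K (mu_ z.2) z.1) @ filter_prod (nbhs x) F
    --> kernel_avg K mu x.
  apply: (@kernel_int_cvg R M cM M K x I F FF mu_ mu _ _ muc).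
    by move=> y; exact: cK.
  by apply: (@filterE _ (nbhs x)) => x'; exact: slice2.
exact: (cvgM c1 (cvgV (mobility_neq0 mu x) c2)).
Qed.

End Dissipation.

(** * The lemma of du Bois-Reymond *)

Section OneDimensional.
Context {R : realType}.
Implicit Types (h l eta deta : R -> R).

Definition weak_derivative h l : Prop := forall (T : R) eta deta, 0 < T ->
  (forall t : R, is_derive t 1 eta (deta t)) -> continuous deta ->
  (exists a b : R, [/\ 0 < a, b < T & forall t : R, ~ (a <= t <= b) -> eta t = 0]) ->
  \int[lebesgue_measure]_(t in `]0, T[) (deta t * h t + eta t * l t) = 0.

(** The base point [-1] makes the formula valid on both sides of [0]. *)
Lemma continuous_antiderivative (F : R -> R) : continuous F ->
  exists G : R -> R, forall t : R, -1 < t -> is_derive t 1 G (F t).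
Proof.
move=> cF; exists (fun t => \int[lebesgue_measure]_(s in `[-1, t]) F s) => t t1.
have IF : lebesgue_measure.-integrable `[-1, t + 1] (EFin \o F).
  apply: continuous_compact_integrable; first exact: segment_compact.
  exact: continuous_subspaceT.
have [d1 d2] := continuous_FTC1_closed (ltr_pwDr ltr01 (lexx t)) IF t1 (cF t).
by split; [exact: d1|rewrite -derive1E].
Qed.

Lemma derive_continuous (G : R -> R) (g : R) (t : R) :
  is_derive t 1 G g -> {for t, continuous G}.
Proof. by move=> [dG _]; apply/differentiable_continuous/derivable1_diffP. Qed.

Lemma derive_within_continuous (G F : R -> R) (a b : R) :
  (forall t : R, a <= t <= b -> is_derive t 1 G (F t)) ->
  {within `[a, b], continuous G}.
Proof.
move=> dG; apply: derivable_within_continuous => t; rewrite in_itv/= => tab.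
by have [] := dG t tab.
Qed.

Lemma Rintegral_oo_FTC (F G : R -> R) (T : R) : 0 < T -> continuous F ->
  (forall t : R, 0 <= t <= T -> is_derive t 1 G (F t)) ->
  \int[lebesgue_measure]_(t in `]0, T[) F t = G T - G 0.
Proof.
move=> T0 cF dG.
have cG := derive_within_continuous dG.
have mF : measurable_fun `]0, T[ (EFin \o F).
  apply/measurable_EFinP; apply: measurable_funTS.
  exact: continuous_measurable_fun.
rewrite /Rintegral -(integral_itv_bndoo true false mF).
rewrite (@continuous_FTC2 _ F G 0 T)//.
- exact: continuous_subspaceT.
- split.
  + by move=> t; rewrite in_itv/= => /andP[/ltW t0 /ltW t1]; have [] := dG t (introT andP (conj t0 t1)).
  + by apply: cvg_at_right_filter; apply: (derive_continuous (dG 0 _)); rewrite lexx ltW.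
  + by apply: cvg_at_left_filter; apply: (derive_continuous (dG T _)); rewrite lexx ltW.
- move=> t; rewrite in_itv/= => /andP[/ltW t0 /ltW t1].
  by rewrite derive1E; have [_ ->] := dG t (introT andP (conj t0 t1)).
Qed.

Let pos (s : R) : R := Num.max 0 s.

(** The error in the difference quotient is at most [|h|], whatever the signs. *)
Let is_derive_pos2 (s : R) : is_derive s 1 (fun r => (pos r) ^+ 2) (2 * pos s).
Proof.
apply/is_derive_near/cvgrPdist_le => e e0; near=> h.
have h0 : h != 0 by near: h; exact: nbhs_dnbhs_neq.
have he : `|h| <= e by near: h; exact: dnbhs0_le.
have hn : 0 < `|h| by rewrite normr_gt0.
have -> : h *: 1 + s = s + h by rewrite [h *: 1]mulr1 addrC.
have -> : 2 * pos s - h^-1 *: ((pos (s + h)) ^+ 2 - (pos s) ^+ 2) =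
    h^-1 * (2 * h * pos s - (pos (s + h) ^+ 2 - pos s ^+ 2)).
  by rewrite mulrBr -mulrA [h * pos s]mulrC !mulrA [h^-1 * 2 * _ * h]mulrC
    !mulrA divff// mul1r.
rewrite normrM normfV ler_pdivrMl//.
apply: (@le_trans _ _ (h * h)).
  rewrite /pos; case: (lerP s 0) => s0; case: (lerP (s + h) 0) => sh0;
    rewrite ?expr0n/= ler_norml; apply/andP; split; nra.
have -> : h * h = `|h| * `|h| by rewrite -normrM ger0_norm// -expr2 sqr_ge0.
by rewrite ler_wpM2l.
Unshelve. all: by end_near. Qed.

Variable dl : R.
Hypothesis dl0 : 0 < dl.

Let hat (s : R) : R := pos (s + dl) - 2 * pos s + pos (s - dl).
Let step (s : R) : R :=
  ((pos (s + dl)) ^+ 2 - 2 * (pos s) ^+ 2 + (pos (s - dl)) ^+ 2) / 2.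

Let is_derive_step (s : R) : is_derive s 1 step (hat s).
Proof.
have sh (k : R) : is_derive s 1 (fun r => (pos (r + k)) ^+ 2) (2 * pos (s + k)).
  apply/is_derive_near; have /is_derive_near H := is_derive_pos2 (s + k).
  apply: cvg_trans (near_eq_cvg _) H; apply: (@filterE _ (0 : R)^') => h.
  by rewrite addrA.
have D := is_deriveZ 2^-1 (is_deriveD (is_deriveB (sh dl) (is_deriveZ 2 (sh 0)))
  (sh (- dl))).
rewrite (_ : step = 2^-1 \*: ((fun r => (pos (r + dl)) ^+ 2) -
  2 \*: (fun r => (pos (r + 0)) ^+ 2) + (fun r => (pos (r - dl)) ^+ 2))).
  apply: (is_derive_eq D); rewrite addr0 /hat.
  by rewrite /GRing.scale/=; field.
by apply/funext => r; rewrite /step !fctE /= addr0 mulrC.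
Qed.

Let hat_continuous : continuous hat.
Proof.
have cp : continuous pos.
  by move=> s; apply: continuous_max => //; exact: cvg_cst.
have sh (k : R) : continuous (fun s => pos (s + k)).
  move=> s; apply: (@continuous_comp _ _ _ (fun s => s + k) pos); last exact: cp.
  by apply: cvgD; [exact: cvg_id|exact: cvg_cst].
move=> s; apply: cvgD; last exact: sh.
apply: cvgB; first exact: sh.
by apply: cvgM; [exact: cvg_cst|exact: cp].
Qed.

Let hat_ge0 s : 0 <= hat s.
Proof.
rewrite /hat /pos; case: (lerP (s + dl) 0) => h1; case: (lerP s 0) => h2;
  case: (lerP (s - dl) 0) => h3; move: dl0 h1 h2 h3; lra.
Qed.

Let hat_out s : dl <= `|s| -> hat s = 0.
Proof.
rewrite ler_normr /hat /pos => /orP[] h0;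
case: (lerP (s + dl) 0) => h1; case: (lerP s 0) => h2;
  case: (lerP (s - dl) 0) => h3; move: dl0 h0 h1 h2 h3; lra.
Qed.

Let hat_in s : `|s| < dl -> 0 < hat s.
Proof.
rewrite ltr_norml /hat /pos => /andP[h4 h5];
case: (lerP (s + dl) 0) => h1; case: (lerP s 0) => h2;
  case: (lerP (s - dl) 0) => h3; move: dl0 h4 h5 h1 h2 h3; lra.
Qed.

Let step_left s : s <= - dl -> step s = 0.
Proof.
rewrite /step /pos => h0.
by rewrite !max_l ?expr0n/= ?mulr0 ?subr0 ?addr0 ?mul0r//; move: dl0 h0; lra.
Qed.

Let step_right s : dl <= s -> step s = dl ^+ 2.
Proof.
rewrite /step /pos => h0.
by rewrite !max_r; [field|move: dl0 h0; lra..].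
Qed.

(** The second difference of [s_+^2 / 2] is a continuously differentiable step
    whose derivative is a hat function. *)
Lemma C1_step : exists step_ hat_ : R -> R,
  [/\ (forall s : R, is_derive s 1 step_ (hat_ s)) /\ continuous hat_,
      (forall s, s <= - dl -> step_ s = 0) /\ (forall s, dl <= s -> step_ s = dl ^+ 2),
      forall s, 0 <= hat_ s,
      forall s, dl <= `|s| -> hat_ s = 0 &
      forall s, `|s| < dl -> 0 < hat_ s].
Proof. by exists step, hat. Qed.

End OneDimensional.

Section WeakDerivative.
Context {R : realType}.
Variables h l : R -> R.
Hypotheses (ch : continuous h) (cl : continuous l).
Hypothesis hl : weak_derivative h l.

(** If [H = h - L], with [L] an antiderivative of [l], took a larger value at
    [a] than at [b], then a test function whose derivative is a hat at [a] minus
    a hat at [b] would give [int eta' H > 0]. *)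
Lemma weak_derivative_cst (L : R -> R) (a b : R) :
  (forall t : R, -1 < t -> is_derive t 1 L (l t)) ->
  0 < a -> 0 < b -> h a - L a <= h b - L b.
Proof.
move=> dL a0 b0; rewrite leNgt; apply/negP => Hba.
pose H t := h t - L t; pose c := (H a + H b) / 2.
have Hac : c < H a by rewrite /c /H; move: Hba; lra.
have Hbc : H b < c by rewrite /c /H; move: Hba; lra.
have cL (t : R) : 0 < t -> {for t, continuous L}.
  by move=> t0; apply: derive_continuous (dL t _); rewrite (lt_trans _ t0)// ltrN10.
have cH (t : R) : 0 < t -> {for t, continuous H}.
  by move=> t0; apply: cvgB; [exact: ch|exact: cL].
have [dl [dl0 dla dlb [Ha Hb]]] : exists dl : R, [/\ 0 < dl, dl < a, dl < b &
    (forall t, `|t - a| < dl -> c < H t) /\ (forall t, `|t - b| < dl -> H t < c)].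
  have na : nbhs a [set t | c < H t].
    exact: (@cvgr_gt _ _ (nbhs a) _ H (H a) (cH a a0) c Hac).
  have nb : nbhs b [set t | H t < c].
    exact: (@cvgr_lt _ _ (nbhs b) _ H (H b) (cH b b0) c Hbc).
  have [ra /= ra0 Ra] := na; have [rb /= rb0 Rb] := nb.
  exists (Num.min (Num.min ra rb) (Num.min (a / 2) (b / 2))); split.
  - by rewrite !lt_min ra0 rb0 !divr_gt0.
  - by rewrite !gt_min; apply/orP; right; apply/orP; left; lra.
  - by rewrite !gt_min; apply/orP; right; apply/orP; right; lra.
  - split=> t; rewrite !lt_min => /andP[/andP[h1 h2] _].
      by apply: Ra; rewrite /ball_/= distrC.
    by apply: Rb; rewrite /ball_/= distrC.
have [st [hat [[dst chat] [stl str] hat0 hatout hatin]]] := C1_step dl0.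
pose eta (t : R) := st (t - a) - st (t - b).
pose rho (t : R) := hat (t - a) - hat (t - b).
have sh (G G' : R -> R) (k t : R) : (forall s : R, is_derive s 1 G (G' s)) ->
    is_derive t 1 (fun r => G (r - k)) (G' (t - k)).
  move=> dG; apply/is_derive_near; have /is_derive_near HH := dG (t - k).
  apply: cvg_trans (near_eq_cvg _) HH; apply: (@filterE _ (0 : R)^') => r.
  by rewrite addrA.
have deta (t : R) : is_derive t 1 eta (rho t).
  by apply: is_deriveB; exact: sh.
have crho : continuous rho.
  have s1 k : continuous (fun t => hat (t - k)).
    move=> t; apply: (@continuous_comp _ _ _ (fun t => t - k) hat); last exact: chat.
    by apply: cvgB; [exact: cvg_id|exact: cvg_cst].
  by move=> t; apply: cvgB; exact: s1.
pose T := a + b + dl; have T0 : 0 < T by rewrite /T; lra.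
have aT : a < T by rewrite /T; lra.
have eta_out t : ~ (Num.min a b - dl <= t <= Num.max a b + dl) -> eta t = 0.
  move/negP; rewrite negb_and -!ltNge => /orP[].
    rewrite ltrBrDr lt_min => /andP[h1 h2].
    by rewrite /eta !stl ?subrr//; lra.
  rewrite -ltrBrDr gt_max => /andP[h1 h2].
  by rewrite /eta !str ?subrr//; lra.
have sgn t : 0 <= rho t * (H t - c).
  have := Ha t; have := Hb t; have := hatin (t - a); have := hatout (t - a).
  have := hatin (t - b); have := hatout (t - b); rewrite /rho.
  case: (ltrP `|t - a| dl) => ta; case: (ltrP `|t - b| dl) => tb.
  - move=> _ _ _ _ /(_ isT) h1 /(_ isT) h2; lra.
  - move=> /(_ isT) -> _ _ /(_ isT) h1 _ /(_ isT) h2.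
    by rewrite subr0 mulr_ge0; lra.
  - move=> _ /(_ isT) h1 /(_ isT) -> _ /(_ isT) h2 _.
    by rewrite sub0r -mulrNN opprK mulr_ge0//; lra.
  - by move=> /(_ isT) -> _ /(_ isT) -> *; rewrite subrr mul0r.
(* [L] is an antiderivative only beyond [-1]; the truncation of [t] at [0]
   makes the integrand continuous on the line. *)
pose q (t : R) := rho t * (H (Num.max 0 t) - c).
have cmax : continuous (Num.max (0 : R)).
  by move=> t; apply: (@continuous_max _ R (fun=> 0) id t); [exact: cvg_cst|exact: cvg_id].
have cq : continuous q.
  move=> t; apply: cvgM; first exact: crho.
  apply: cvgB; last exact: cvg_cst.
  apply: (@continuous_comp _ _ _ (Num.max (0 : R)) H); first exact: cmax.
  have t0 : 0 <= Num.max 0 t by rewrite le_max lexx.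
  apply: cvgB; first exact: ch.
  by apply: derive_continuous (dL _ _); rewrite (lt_le_trans _ t0)// ltrN10.
have [Q dQ] := continuous_antiderivative cq.
have dQ' (t : R) : 0 <= t -> is_derive t 1 Q (rho t * (H t - c)).
  move=> t0; have := dQ t; rewrite /q max_r//; apply.
  by rewrite (lt_le_trans _ t0)// ltrN10.
have eta0 : eta 0 = 0.
  by apply: eta_out => /andP[+ _]; rewrite lerBlDr ge_min => /orP[]; lra.
have etaT : eta T = 0.
  by apply: eta_out => /andP[_ +]; rewrite -lerBlDr le_max => /orP[]; rewrite /T; lra.
have cF : continuous (fun t => rho t * h t + eta t * l t).
  move=> t; apply: cvgD; apply: cvgM; [exact: crho|exact: ch| |exact: cl].
  exact: derive_continuous (deta t).
(* [rho h + eta l = rho (H - c) + (eta L)' + c eta'], and [eta] vanishes at [0]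
   and [T], so that [Q] takes the same value at both ends. *)
have dG (t : R) : 0 <= t <= T -> is_derive t 1 (Q + (eta * L + c \*: eta))
    (rho t * h t + eta t * l t).
  move=> /andP[t0 _]; have tL : is_derive t 1 L (l t).
    by apply: dL; rewrite (lt_le_trans _ t0)// ltrN10.
  apply: (is_derive_eq (is_deriveD (dQ' t t0)
    (is_deriveD (is_deriveM (deta t) tL) (is_deriveZ c (deta t))))).
  by rewrite /GRing.scale/= /H; ring.
have := hl T0 deta crho; rewrite (Rintegral_oo_FTC T0 cF dG).
have supp : exists a' b' : R, [/\ 0 < a', b' < T &
    forall t : R, ~ (a' <= t <= b') -> eta t = 0].
  exists (Num.min a b - dl), (Num.max a b + dl); split; last exact: eta_out.
    by rewrite subr_gt0 lt_min dla dlb.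
  by rewrite /T ltrD2r gt_max; apply/andP; split; lra.
move=> /(_ supp); rewrite !fctE/= eta0 etaT !scaler0 !mul0r !addr0 => /eqP.
rewrite subr_eq0 => /eqP QT.
have inc (s t : R) : 0 <= s -> s <= t -> exists2 r, s <= r <= t &
    Q t - Q s = rho r * (H r - c) * (t - s).
  move=> s0 st0; have [||r] := @MVT_segment R Q (fun t => rho t * (H t - c)) s t st0.
  - by move=> r; rewrite in_itv/= => /andP[sr _]; apply: dQ'; rewrite (le_trans s0)// ltW.
  - apply: (@derive_within_continuous _ Q (fun t => rho t * (H t - c))) => r /andP[sr _].
    by apply: dQ'; exact: le_trans sr.
  - by rewrite in_itv/= => rst E; exists r.
have mono (s t : R) : 0 <= s -> s <= t -> Q s <= Q t.
  move=> s0 st0; have [r _ E] := inc s t s0 st0.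
  by rewrite -subr_ge0 E mulr_ge0// subr_ge0.
have [r /andP[r1 r2] E] := inc a (a + dl / 2) (ltW a0) (ltac:(lra)).
have Hr : c < H r by apply: Ha; rewrite ger0_norm; lra.
have rhor : 0 < rho r.
  rewrite /rho [hat (r - b)]hatout ?subr0.
    by apply: hatin; rewrite ger0_norm; lra.
  by rewrite leNgt; apply/negP => /Hb; move: Hr; lra.
have : 0 < Q (a + dl / 2) - Q a.
  by rewrite E !mulr_gt0// ?subr_gt0//; lra.
have := mono 0 a (lexx 0) (ltW a0); have := mono (a + dl / 2) T.
move=> /(_ (ltac:(lra)) (ltac:(rewrite /T; lra))); lra.
Qed.

(** A continuous function with a continuous weak derivative is differentiable
    (the lemma of du Bois-Reymond). *)
Lemma weak_derivative_is_derive (t : R) : 0 < t -> is_derive t 1 h (l t).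
Proof.
move=> t0; have [L dL] := continuous_antiderivative cl.
have tL : is_derive t 1 L (l t) by apply: dL; rewrite (lt_trans _ t0)// ltrN10.
have := is_deriveD tL (is_derive_cst (h t - L t) t 1); rewrite addr0.
apply: near_eq_is_derive; apply: filterS (lt_nbhsr t0) => s s0.
have := weak_derivative_cst dL t0 s0; have := weak_derivative_cst dL s0 t0.
by rewrite !fctE /cst/=; lra.
Qed.

End WeakDerivative.

(** * Testing the equation with a potential *)

Section ProductTests.
Context {R : realType} {d : nat} {M : ptopologicalType}.
Context {A : smoothManifold R d M}.
Hypothesis cM : compact [set: M].

Lemma is_derive_fst (V1 V2 W : normedModType R) (f : V1 -> W) (p v : V1 * V2)
    (D : W) : is_derive p.1 v.1 f D -> is_derive p v (f \o fst) D.
Proof.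
move=> /is_derive_near H; apply/is_derive_near; apply: cvg_trans (near_eq_cvg _) H.
by apply: (@filterE _ (0 : R)^').
Qed.

Lemma is_derive_snd (V1 V2 W : normedModType R) (f : V2 -> W) (p v : V1 * V2)
    (D : W) : is_derive p.2 v.2 f D -> is_derive p v (f \o snd) D.
Proof.
move=> /is_derive_near H; apply/is_derive_near; apply: cvg_trans (near_eq_cvg _) H.
by apply: (@filterE _ (0 : R)^').
Qed.

Lemma product_C1 (U : set 'rV[R]_d) (T : set R) (f : 'rV[R]_d -> R^o)
    (eta deta : R -> R) : open U -> open T -> Ck_on 1 U f ->
  (forall t : R, is_derive t 1 eta (deta t)) -> continuous deta ->
  Ck_on 1 (U `*` T) (fun p : 'rV[R]_d * R^o => f p.1 * eta p.2 : R^o).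
Proof.
move=> oU oT cf de cde.
have ce : continuous eta by move=> t; exact: derive_continuous (de t).
have ceta (p : 'rV[R]_d * R^o) : (eta \o snd) @ p --> eta p.2.
  exact: (cvg_comp snd eta cvg_snd (ce p.2)).
have cdeta (p : 'rV[R]_d * R^o) : (deta \o snd) @ p --> deta p.2.
  exact: (cvg_comp snd deta cvg_snd (cde p.2)).
have cfst (p : 'rV[R]_d * R^o) : U p.1 -> (f \o fst) @ p --> f p.1.
  by move=> Up; exact: (cvg_comp fst f cvg_fst (C1_continuous cf Up)).
split; first by move=> p [Up _]; exact: (cvgM (cfst p Up) (ceta p)).
move=> v; have D (p : 'rV[R]_d * R^o) : (U `*` T) p ->
    is_derive p v (fun p : 'rV[R]_d * R^o => f p.1 * eta p.2 : R^o)
      (f p.1 * (v.2 * deta p.2) + eta p.2 * 'D_(v.1) f p.1).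
  move=> [Up _].
  have d1 : is_derive p v (f \o fst) ('D_(v.1) f p.1).
    by apply: is_derive_fst; apply: derivableP; exact: (C1_derivable cf).
  have d2 : is_derive p v (eta \o snd : _ -> R^o) (v.2 * deta p.2).
    apply: is_derive_snd; have := is_deriveZ_dir v.2 (de p.2).
    by rewrite [v.2 *: 1]mulr1.
  exact: (is_deriveM d1 d2).
split; first by move=> p /D[].
split=> // p [Up Tp].
have cD : (fun p : 'rV[R]_d * R^o => 'D_(v.1) f p.1) @ p --> 'D_(v.1) f p.1.
  exact: (cvg_comp fst ('D_(v.1) f) cvg_fst
    (C1_derive_continuous cf (v := v.1) Up)).
have c1 : (fun p : 'rV[R]_d * R^o => f p.1 * (v.2 * deta p.2) +
    eta p.2 * 'D_(v.1) f p.1) @ p -->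
    f p.1 * (v.2 * deta p.2) + eta p.2 * 'D_(v.1) f p.1.
  exact: (cvgD (cvgM (cfst p Up) (cvgM (cvg_cst v.2) (cdeta p)))
    (cvgM (ceta p) cD)).
rewrite /prop_for/= /continuous_at; have [_ ->] := D p (conj Up Tp).
apply: cvg_trans (near_eq_cvg _) c1.
exists (U, T); first by split; apply: open_nbhs_nbhs.
by move=> [q s] Hqs; have [_ ->] := D (q, s) Hqs.
Qed.

Lemma product_test f (eta deta : R -> R) (T : R) : C1_manifold A f ->
  (forall t : R, is_derive t 1 eta (deta t)) -> continuous deta ->
  (exists a b : R, [/\ 0 < a, b < T & forall t : R, ~ (a <= t <= b) -> eta t = 0]) ->
  test_function A T (fun p => f p.1 * eta p.2).
Proof.
move=> cf de cde [a [b [a0 bT supp]]]; split.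
  move=> i; apply: (product_C1 (f := f \o chart_inv i) _ _ (cf i) de cde).
    exact: chart_img_open.
  exact: interval_open.
exists ([set: M] `*` `[a, b]).
  split; first by apply: compact_setX => //; exact: segment_compact.
  move=> [x t] [_ /=]; rewrite !in_itv/= => /andP[a1 b1]; split => //=.
  by rewrite (lt_le_trans a0 a1) (le_lt_trans b1 bT).
move=> [x t] nS; rewrite /= supp ?mulr0// => tab; apply: nS.
by split => //=; rewrite in_itv/=.
Qed.

End ProductTests.

Section WeakSolutions.
Context {R : realType} {d : nat} {M : ptopologicalType}.
Context {A : smoothManifold R d M} (g : riemannianMetric A).
Hypothesis cM : compact [set: M].
Variables (K W : M * M -> R) (C : R).
Hypothesis W1 : forall i j : atlas A, Ck_on 1 (chart_img i `*` chart_img j)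
  (fun p : 'rV[R]_d * 'rV[R]_d => W (chart_inv i p.1, chart_inv j p.2) : R^o).
Hypotheses (cK : continuous K) (C0 : 0 < C) (KC : forall x y, C <= K (x, y)).
Variable mu : R -> borelProb R M.
Hypothesis mu_sol : weak_solution g K W mu.

(** Freezing the curve at negative times makes it narrowly continuous on the
    whole line. *)
Definition frozen (t : R) : borelProb R M := mu (Num.max 0 t).

Lemma frozenE t : 0 <= t -> frozen t = mu t.
Proof. by move=> t0; rewrite /frozen max_r. Qed.

Lemma frozen_cvg t : narrow_cvg (nbhs t) frozen (frozen t).
Proof.
move=> f cf bf; have t0 : 0 <= Num.max 0 t by rewrite le_max lexx.
have H := mu_sol.1 _ t0 f cf bf.
have cm : Num.max (0 : R) @ t --> within [set s : R | 0 <= s] (nbhs (Num.max 0 t)).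
  move=> B HB.
  have cmax : Num.max (0 : R) @ t --> Num.max 0 t.
    by apply: (@continuous_max _ R (fun=> 0) id t); [exact: cvg_cst|exact: cvg_id].
  apply: (@filterS _ (nbhs t) _ _ _ _ (cmax _ HB)) => s /=; apply.
  by rewrite /= le_max lexx.
exact: (cvg_comp (Num.max (0 : R)) (fun s => \int[mu s]_x f x) cm H).
Qed.

Lemma frozen_int_continuous f : continuous f ->
  continuous (fun t => \int[frozen t]_x f x).
Proof.
move=> cf t; apply: (@ccvg_int R M cM R (nbhs t) _ (fun=> f) f frozen) => //.
- exact: filterE.
- by move=> x; exact: (cvg_comp fst f cvg_fst (cf x)).
- exact: frozen_cvg.
Qed.

Lemma frozen_slope_continuous nu :
  continuous (fun t => slope g K W nu (frozen t)).
Proof.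
move=> t; apply: (slope_cvg cM W1 cK C0 KC (F := nbhs t) (nu_ := fun=> nu) (mu_ := frozen)).
  exact: narrow_cst.
exact: frozen_cvg.
Qed.

(** Testing the equation with [(x, t) |-> W[nu](x) eta(t)]. *)
Lemma potential_decay nu (t : R) : 0 < t ->
  is_derive t 1 (fun t => \int[frozen t]_x kernel_avg W nu x : R)
    (- slope g K W nu (frozen t)).
Proof.
move=> t0; pose f := kernel_avg W nu.
have cf : C1_manifold A f by exact: potential_C1.
have cf0 : continuous f by exact: C1_manifold_continuous.
apply: (@weak_derivative_is_derive R (fun t => \int[frozen t]_x f x)
  (fun t => - slope g K W nu (frozen t))) => //.
- exact: frozen_int_continuous.
- by move=> s; apply: cvgN; exact: frozen_slope_continuous.
move=> T eta deta T0 de cde supp.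
have := mu_sol.2 T T0 _ (product_test cM cf de cde supp).
move=> E; rewrite -[RHS]E; apply: eq_Rintegral => s; rewrite inE/= in_itv/= => /andP[/ltW s0 _].
rewrite frozenE//.
have D1 x : 'D_1 (fun r : R^o => f x * eta r : R^o) s = f x * deta s.
  by have [_ E1] := is_deriveZ (f x) (de s); exact: E1.
have D2 x : differential A (fun y => f y * eta s) x = eta s *: differential A f x.
  apply/rowP => k; rewrite !mxE; set P := (fun y => f y * eta s) \o _.
  have dF := derivableP (C1_derivable (cf (chart_at A x))
    (v := delta_mx 0 k) (chart_mem (chart_at_dom A x))).
  have -> : P = eta s \*: (f \o chart_inv (chart_at A x) : 'rV[R]_d -> R^o).
    by apply/funext => q; exact: mulrC.
  by have [_ E2] := is_deriveZ (eta s) dF; exact: E2.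
rewrite [RHS](_ : _ = \int[mu s]_x (deta s * f x + (- eta s) * flux g K W f (mu s) x)).
  have If : (mu s).-integrable setT (EFin \o f) by exact: continuous_int.
  have Ifl : (mu s).-integrable setT (EFin \o flux g K W f (mu s)).
    by apply: continuous_int => //; exact: (@flux_continuous _ _ _ _ g cM K W C W1 cK C0 KC f (mu s) cf).
  rewrite RintegralD//; [|exact: integrable_scaler..].
  by rewrite !RintegralZl// mulNr mulrN.
apply: eq_Rintegral => x _; rewrite /= D1 D2.
have -> (xi y : 'rV[R]_d) (a : R) : pairing (a *: xi) y = a * pairing xi y.
  by rewrite !pairingE -scalemxAl mxE.
by rewrite pairing_velocity mulrN mulNr mulrC.
Qed.

End WeakSolutions.

(** * Measures of slope zero are stationary *)

Section TestFunctions.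
Context {R : realType} {d : nat} {M : ptopologicalType}.
Context {A : smoothManifold R d M}.
Variables (T : R) (phi : M * R -> R).
Hypothesis test : test_function A T phi.

Local Notation dphi := (fun z : M * R => 'D_1 (fun s : R^o => phi (z.1, s) : R^o) z.2).
Local Notation Phi i := (fun p : 'rV[R]_d * R^o => phi (chart_inv i p.1, p.2) : R^o).

Lemma test_C1_slice (t : R) : 0 < t < T -> C1_manifold A (fun x => phi (x, t)).
Proof.
move=> t0T i; have [cPhi DPhi] := test.1 i.
have U p : chart_img i p -> (chart_img i `*` [set` `]0, T[]) (p, t).
  by move=> ip; split => //=; rewrite in_itv.
have cpair (p : 'rV[R]_d) : (fun q => (q, t) : 'rV[R]_d * R^o) @ p --> (p, t).
  move=> B [[B1 B2] [/= pB1 tB2] B12]; apply: (@filterS _ (nbhs p) _ _ _ _ pB1) => q qB1.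
  by apply: B12; split => //=; exact: nbhs_singleton tB2.
split; first by move=> p ip; exact: (cvg_comp _ (Phi i) (cpair p) (cPhi _ (U p ip))).
move=> v; have [h1 [h2 _]] := DPhi (v, 0).
have D p : chart_img i p -> is_derive p v
    ((fun x => phi (x, t)) \o chart_inv i : 'rV[R]_d -> R^o)
    ('D_((v, 0) : 'rV[R]_d * R^o) (Phi i) (p, t)).
  move=> ip; exact: (is_derive_slice1 (derivableP (h1 (p, t) (U p ip)))).
split; first by move=> p /D[].
split=> // p ip; rewrite /prop_for/= /continuous_at; have [_ ->] := D p ip.
have c := cvg_comp _ ('D_((v, 0) : 'rV[R]_d * R^o) (Phi i)) (cpair p) (h2 _ (U p ip)).
apply: cvg_trans (near_eq_cvg _) c.
by apply: filterS (chart_img_nbhs ip) => q iq; have [_ ->] := D q iq.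
Qed.

(** The support is compact in [M * R], so its projection to the time axis is
    closed: beyond it, [phi] vanishes for all [x] at once. *)
Let outside (t : R) : ~ (0 < t < T) ->
  \forall s \near t, forall x, phi (x, s) = 0.
Proof.
move=> nt; have [S [cS SU] S0] := test.2.
have cS2 : compact (snd @` S).
  by apply: continuous_compact => //; apply: continuous_subspaceT => p; exact: cvg_snd.
have : nbhs t (~` (snd @` S)).
  apply: open_nbhs_nbhs; split.
    by apply: closed_openC; exact: (compact_closed (@Rhausdorff R)).
  by move=> [[x s] /SU[_ /=] + /= st]; rewrite st in_itv /= => ?; exact: nt.
by apply: filterS => s ns x; apply: S0 => Ss; apply: ns; exists (x, s).
Qed.

Let chart_time_cvg (i : atlas A) x (t : R) (F : 'rV[R]_d * R^o -> R) : chart_dom i x ->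
  {for (chart i x, t), continuous F} ->
  (fun z : M * R => F (chart i z.1, z.2)) @ (x, t) --> F (chart i x, t).
Proof.
move=> ix cF; apply: (cvg_comp (fun z : M * R => (chart i z.1, z.2)) F _ cF).
apply: (@cvg_pair _ _ _ _ (nbhs (chart i x)) (nbhs t)); last exact: cvg_snd.
exact: (cvg_comp fst (chart i) cvg_fst (chart_cvg ix)).
Qed.

Let box (x : M) (i : atlas A) (t : R) : chart_dom i x -> 0 < t < T ->
  \forall z \near (x, t), chart_dom i z.1 /\ 0 < z.2 < T.
Proof.
move=> ix t0T; exists (chart_dom i, [set s | s \in `]0, T[]).
  split => /=; first exact: chart_nbhs.
  by apply: near_in_itvoo; rewrite in_itv.
by move=> [y s] [/= iy]; rewrite in_itv.
Qed.

Lemma test_continuous : continuous phi.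
Proof.
move=> [x t]; have [t0T|nt] := pselect (0 < t < T).
  pose i := chart_at A x; have ix : chart_dom i x := chart_at_dom A x.
  have [cPhi _] := test.1 i.
  have Ut : (chart_img i `*` [set` `]0, T[]) (chart i x, t).
    by split => /=; [exact: chart_mem|rewrite in_itv].
  have c := chart_time_cvg ix (cPhi _ Ut).
  rewrite /continuous_at; suff : phi @ (x, t) --> Phi i (chart i x, t).
    by rewrite /= chartK.
  apply: cvg_trans (near_eq_cvg _) c.
  by apply: filterS (box ix t0T) => -[y s] [/= iy _]; rewrite chartK.
rewrite /continuous_at (nbhs_singleton (outside nt)).
apply: cvg_trans (near_eq_cvg _) (cvg_cst (0 : R)).
exists (setT, [set s | forall x, phi (x, s) = 0]).
  by split; [exact: filterT|exact: outside].
by move=> [y s] [_ /= ->].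
Qed.

Let time_derive (i : atlas A) x (t : R) : chart_dom i x -> 0 < t < T ->
  is_derive (t : R^o) 1 (fun s : R^o => phi (x, s) : R^o)
    ('D_((0, 1) : 'rV[R]_d * R^o) (Phi i) (chart i x, t)).
Proof.
move=> ix t0T; have [_ /(_ (0, 1))[h1 _]] := test.1 i.
have Ut : (chart_img i `*` [set` `]0, T[]) (chart i x, t).
  by split => /=; [exact: chart_mem|rewrite in_itv].
have := is_derive_slice2 (derivableP (h1 _ Ut)).
by apply: near_eq_is_derive; apply: (@filterE _ (nbhs t)) => s; rewrite /= chartK.
Qed.

Let time_derive0 x (t : R) : ~ (0 < t < T) ->
  is_derive (t : R^o) 1 (fun s : R^o => phi (x, s) : R^o) 0.
Proof.
move=> /outside H; apply: near_eq_is_derive (is_derive_cst (0 : R^o) (t : R^o) 1).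
by apply: filterS H => s ->.
Qed.

Lemma test_derive x (t : R) :
  is_derive (t : R^o) 1 (fun s : R^o => phi (x, s) : R^o) (dphi (x, t)).
Proof.
apply: derivableP; have [t0T|nt] := pselect (0 < t < T).
  by have [] := time_derive (chart_at_dom A x) t0T.
by have [] := time_derive0 x nt.
Qed.

Lemma test_derive_continuous : continuous dphi.
Proof.
move=> [x t]; have [t0T|nt] := pselect (0 < t < T).
  pose i := chart_at A x; have ix : chart_dom i x := chart_at_dom A x.
  have [_ /(_ (0, 1))[_ [h2 _]]] := test.1 i.
  have Ut : (chart_img i `*` [set` `]0, T[]) (chart i x, t).
    by split => /=; [exact: chart_mem|rewrite in_itv].
  have c := chart_time_cvg ix (h2 _ Ut).
  rewrite /continuous_at/=; have [_ ->] := time_derive ix t0T.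
  apply: cvg_trans (near_eq_cvg _) c.
  apply: filterS (box ix t0T) => -[y s] [/= iy s0T].
  by have [_ ->] := time_derive iy s0T.
rewrite /continuous_at/=; have [_ ->] := time_derive0 x nt.
apply: cvg_trans (near_eq_cvg _) (cvg_cst (0 : R)).
exists (setT, [set s | forall x, 'D_1 (fun r : R^o => phi (x, r) : R^o) s = 0]).
  split; first exact: filterT.
  have := outside nt; rewrite /prop_near1 nbhsE => -[B [oB Bt] sB].
  exists B => // s Bs x'.
  have [_ //] : is_derive (s : R^o) 1 (fun r : R^o => phi (x', r) : R^o) 0.
  apply: near_eq_is_derive (is_derive_cst (0 : R^o) (s : R^o) 1).
  by apply: filterS (open_nbhs_nbhs (conj oB Bs)) => r /sB ->.
by move=> [y s] [_ /= ->].
Qed.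

Lemma test_boundary x : phi (x, 0) = 0 /\ phi (x, T) = 0.
Proof.
have n0 : ~ (0 < (0 : R) < T) by rewrite ltxx.
have nT : ~ (0 < T < T) by rewrite ltxx andbF.
by split; [exact: nbhs_singleton (outside n0) x|exact: nbhs_singleton (outside nT) x].
Qed.

End TestFunctions.

Section Stationary.
Context {R : realType} {d : nat} {M : ptopologicalType}.
Context {A : smoothManifold R d M} (g : riemannianMetric A).
Hypothesis cM : compact [set: M].
Variables (K W : M * M -> R) (C : R).
Hypothesis W1 : forall i j : atlas A, Ck_on 1 (chart_img i `*` chart_img j)
  (fun p : 'rV[R]_d * 'rV[R]_d => W (chart_inv i p.1, chart_inv j p.2) : R^o).
Hypotheses (cK : continuous K) (C0 : 0 < C) (KC : forall x y, C <= K (x, y)).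

(** The transport term vanishes, and what remains is the integral in time of
    the derivative of [t |-> int phi(x, t) dmu(x)]. *)
Lemma slope0_stationary (mu : borelProb R M) :
  slope g K W mu mu = 0 -> stationary_solution g K W mu.
Proof.
move=> s0; split=> [t _|T T0 phi test]; first exact: narrow_cst.
pose dphi (z : R * M) : R^o := 'D_1 (fun s : R^o => phi (z.2, s) : R^o) z.1.
have cphi : continuous (fun z : R * M => phi (z.2, z.1)).
  move=> [t x]; apply: (cvg_comp (fun z : R * M => (z.2, z.1)) phi _ (@test_continuous _ _ _ _ _ _ test (x, t))).
  by apply: (@cvg_pair _ _ _ _ (nbhs x) (nbhs t)); [exact: cvg_snd|exact: cvg_fst].
have cdphi : continuous dphi.
  move=> [t x]; apply: (cvg_comp (fun z : R * M => (z.2, z.1)) _ _ (@test_derive_continuous _ _ _ _ _ _ test (x, t))).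
  by apply: (@cvg_pair _ _ _ _ (nbhs x) (nbhs t)); [exact: cvg_snd|exact: cvg_fst].
have csl t : continuous (fun x => dphi (t, x)) by apply: slice_continuous => x; exact: cdphi.
transitivity (\int[lebesgue_measure]_(t in `]0, T[) \int[mu]_x dphi (t, x)).
  apply: eq_Rintegral => t; rewrite inE/= in_itv/= => t0T.
  have cf := test_C1_slice test t0T.
  have cfl := @flux_continuous _ _ _ _ g cM K W C W1 cK C0 KC _ mu cf.
  rewrite (_ : \int[mu]_x _ = \int[mu]_x (dphi (t, x) - flux g K W (fun x => phi (x, t)) mu x)); last first.
    by apply: eq_Rintegral => x _; rewrite pairing_velocity.
  rewrite RintegralB//; [|exact: continuous_int..].
  by rewrite (slope_eq0 cM W1 cK C0 KC cf s0) subr0.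
have cF : continuous (fun t : R => \int[mu]_x dphi (t, x)).
  move=> t; apply: (kernel_int_continuous cM (Phi := dphi)); first by move=> x; exact: cdphi.
  exact: filterE.
have dG (t : R) : 0 <= t <= T -> is_derive t 1 (fun t : R => \int[mu]_x phi (x, t))
    (\int[mu]_x dphi (t, x)).
  move=> _; apply: (@is_derive_kernel_int R M cM R^o (fun z => phi (z.2, z.1))
    dphi setT) => //.
  - exact: openT.
  - move=> s _; apply: (@slice_continuous _ _ R (fun z => phi (z.2, z.1)) s) => x.
    exact: cphi.
  - by move=> s x _; exact: (test_derive test).
  - by move=> x; exact: cdphi.
rewrite (Rintegral_oo_FTC T0 cF dG).
have z (t : R) : (forall x, phi (x, t) = 0) -> \int[mu]_x phi (x, t) = 0.
  by move=> H; under eq_Rintegral do rewrite H; exact: int_cst.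
by rewrite !z ?subrr// => x; have [] := test_boundary test x.
Qed.

End Stationary.

(** * Decay of the energy *)

Section SymmetricKernel.
Context {R : realType} {M : ptopologicalType}.
Hypothesis cM : compact [set: M].
Hypothesis scM : @second_countable M.
Local Notation B := (g_sigma_algebraType (@open M)).

(** By second countability an open subset of the product is a countable union of
    open boxes, hence measurable for the product of the Borel sets. *)
Lemma continuous_measurable_pair (W : M * M -> R) : continuous W ->
  measurable_fun [set: B * B] W.
Proof.
move=> /continuousP cW; have [b [ob hb]] := basis_enumeration scM.
apply: (measurability _ (RGenOpens.measurableE R)).
move=> _ [_ [r [s ->] <-]]; rewrite setTI.
have oU : open (W @^-1` `]r, s[%classic) by apply: cW; exact: interval_open.
set U := W @^-1` _ in oU *.
have -> : U = \bigcup_k \bigcup_(l in [set l | b k `*` b l `<=` U]) (b k `*` b l).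
  apply/seteqP; split=> [[x y] Uxy|z [k _ [l bU /bU]]//].
  have [[V1 V2] [/= xV1 yV2] V12] : nbhs (x, y) U by exact: open_nbhs_nbhs.
  have [k [bkx bkV]] := hb x _ xV1; have [l [bly blV]] := hb y _ yV2.
  exists k => //; exists l => // -[x' y'] [/= h1 h2].
  by apply: V12; split; [exact: bkV|exact: blV].
apply: bigcup_measurable => k _; apply: bigcup_measurable => l _.
by apply: measurableX; apply: open_borel.
Qed.

Lemma symmetric_kernel_int (W : M * M -> R) (mu nu : borelProb R M) :
  continuous W -> (forall x y, W (x, y) = W (y, x)) ->
  \int[mu]_x kernel_avg W nu x = \int[nu]_x kernel_avg W mu x.
Proof.
move=> cW sW.
have cMM : compact [set: M * M].
  by rewrite -setXTT; apply: compact_setX.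
have [b b0 Wb] := continuous_bounded cMM cW.
have mW := continuous_measurable_pair cW.
have fin (m : borelProb R M) x :
    (\int[m]_y (W (x, y))%:E)%E = (kernel_avg W m x)%:E.
  rewrite fineK//; apply: integrable_fin_num => //; apply: continuous_int => //.
  by apply: slice_continuous => y; exact: cW.
have IW : (mu \x nu)%E.-integrable [set: B * B] (EFin \o W).
  apply: measurable_bounded_integrable => //.
    have E : (mu \x nu)%E [set: B * B] = (mu setT * nu setT)%E.
      by rewrite -product_measure1E// setXTT.
    rewrite [X in (X < _)%E](_ : _ = (mu setT * nu setT)%E); last exact: E.
    by rewrite (probability_setT mu) (probability_setT nu) mule1 ltry.
  exists b; split; first exact: num_real.
  by move=> c bc x _; exact: le_trans (Wb x) (ltW bc).
have := Fubini IW; rewrite /Rintegral => E; congr fine.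
under eq_integral do rewrite -fin.
rewrite E; apply: eq_integral => y _; rewrite -fin.
by apply: eq_integral => x _; rewrite /= sW.
Qed.

End SymmetricKernel.

Section Energy.
Context {R : realType} {d : nat} {M : ptopologicalType}.
Context {A : smoothManifold R d M} (g : riemannianMetric A).
Hypothesis cM : compact [set: M].
Variables (K W : M * M -> R) (C : R).
Hypothesis W1 : forall i j : atlas A, Ck_on 1 (chart_img i `*` chart_img j)
  (fun p : 'rV[R]_d * 'rV[R]_d => W (chart_inv i p.1, chart_inv j p.2) : R^o).
Hypotheses (cK : continuous K) (C0 : 0 < C) (KC : forall x y, C <= K (x, y)).
Hypothesis W_sym : forall x y, W (x, y) = W (y, x).
Variable mu : R -> borelProb R M.
Hypothesis mu_sol : weak_solution g K W mu.
Local Notation m := (frozen mu).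

(** Twice the interaction energy. *)
Definition energy (t : R) : R := \int[m t]_x kernel_avg W (m t) x.

Let b (s t : R) : R := \int[m t]_x kernel_avg W (m s) x.

Let b_sym s t : b s t = b t s.
Proof.
apply: symmetric_kernel_int => //; first exact: (manifold_second_countable A).
exact: (potential_kernel_continuous W1).
Qed.

Let S (s t : R) : R := slope g K W (m s) (m t).

Let b_derive s (t : R) : 0 < t -> is_derive t 1 (b s) (- S s t).
Proof. by move=> t0; exact: (potential_decay cM W1 cK C0 KC mu_sol). Qed.

Let S_cvg (t : R) : (fun z : R * R => S z.1 z.2) @ (t, t) --> S t t.
Proof.
apply: (@slope_cvg _ _ _ _ g cM K W C W1 cK C0 KC _ (nbhs (t, t)) _
  (fun z => m z.1) (fun z => m z.2)).
- by move=> f cf bf; exact: (cvg_comp _ _ cvg_fst (frozen_cvg mu_sol (t := t) cf bf)).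
- by move=> f cf bf; exact: (cvg_comp _ _ cvg_snd (frozen_cvg mu_sol (t := t) cf bf)).
Qed.

(** By symmetry, [b (t+h) (t+h) - b t t] is the increment between [t] and
    [t + h] of [r |-> b (t+h) r + b t r], in which the potential is frozen. *)
Lemma energy_derive (t : R) : 0 < t ->
  is_derive t 1 energy (- (2 * slope g K W (m t) (m t))).
Proof.
move=> t0; apply/is_derive_near/cvgrPdist_lt => e e0.
have e20 : 0 < e / 2 by rewrite divr_gt0.
have /cvgrPdist_lt/(_ _ e20)[[N1 N2] [/= n1 n2] HS] := S_cvg (t := t).
have HS' s r : N1 s -> N2 r -> `|S t t - S s r| < e / 2.
  by move=> h1 h2; exact: (HS (s, r) (conj h1 h2)).
have [r /= r0 Hr] := filterI n1 n2.
near=> h.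
have h0 : h != 0 by near: h; exact: nbhs_dnbhs_neq.
have hr : `|h| < r by near: h; exact: dnbhs0_lt.
have ht : `|h| < t by near: h; exact: dnbhs0_lt.
pose psi (s : R) : R^o := b (t + h) s + b t s.
have dpsi (s : R) : 0 < s -> is_derive s h psi (h * (- S (t + h) s + - S t s)).
  move=> s0; have := is_deriveZ_dir h (is_deriveD (b_derive (t + h) s0) (b_derive t s0)).
  by rewrite [h *: 1]mulr1.
have pos (s : R) : 0 <= s <= 1 -> 0 < t + s *: h.
  move=> /andP[s0 s1]; have : `|s *: h| < t.
    rewrite normrM (ger0_norm s0); apply: le_lt_trans ht.
    by rewrite ler_piMl.
  by rewrite ltr_norml => /andP[h1 _]; lra.
have [s /andP[s0 s1] E] := @mean_value R R^o psi t h
  (fun s s01 => ex_derive (is_derive := dpsi _ (pos s s01))).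
have s01 : 0 <= s <= 1 by rewrite !ltW.
have [_ E'] := dpsi _ (pos s s01).
have -> : h *: 1 + t = t + h by rewrite [h *: 1]mulr1 addrC.
have -> : energy (t + h) - energy t = psi (t + h) - psi t.
  by rewrite /psi /energy -/(b t t) -/(b (t + h) (t + h)) (b_sym t (t + h)); ring.
rewrite E E' [_ *: _]mulKf// -/(S t t).
have near_t u : 0 <= u <= 1 -> N1 (t + u *: h) /\ N2 (t + u *: h).
  move=> /andP[u0 u1]; apply: Hr; rewrite /ball_/= opprD addrA subrr sub0r normrN.
  rewrite normrM (ger0_norm u0); apply: le_lt_trans hr.
  by rewrite ler_piMl.
have [_ Ns] := near_t s s01.
have [Nh _] : N1 (t + 1 *: h) /\ N2 (t + 1 *: h) by apply: near_t; rewrite lexx ler01.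
have [Nt _] : N1 (t + 0 *: h) /\ N2 (t + 0 *: h) by apply: near_t; rewrite lexx ler01.
rewrite scale1r in Nh; rewrite scale0r addr0 in Nt.
have := HS' _ _ Nh Ns; have := HS' _ _ Nt Ns.
move: (S t t) (S (t + h) (t + s *: h)) (S t (t + s *: h)) => x y z xz xy.
rewrite (_ : - (2 * x) - (- y + - z) = (y - x) + (z - x)); last by ring.
by rewrite (le_lt_trans (ler_normD _ _))// (splitr e) ltrD// distrC.
Unshelve. all: by end_near. Qed.

Let energy_bounded : exists2 B : R, 0 < B & forall t, `|energy t| <= B.
Proof.
have cW := potential_kernel_continuous W1.
have cMM : compact [set: M * M] by rewrite -setXTT; apply: compact_setX.
have [B B0 WB] := continuous_bounded cMM cW.
exists B => // t; apply: int_norm_le => [|x].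
  apply: continuous_int => //; apply: (C1_manifold_continuous (A := A)).
  exact: potential_C1.
apply: int_norm_le => [|y]; last exact: WB.
apply: continuous_int => //; apply: slice_continuous => y; exact: cW.
Qed.

(** The energy is bounded, so its mean rate of decay over [[n + 1, 2(n + 1)]]
    tends to 0, and it is attained. *)
Lemma slope_vanishes : exists (t : nat -> R) (B : R),
  forall n, n.+1%:R <= t n /\ slope g K W (mu (t n)) (mu (t n)) <= B / n.+1%:R.
Proof.
have [B B0 eB] := energy_bounded.
have /choice[t Ht] : forall n : nat, exists t : R, n.+1%:R <= t /\
    slope g K W (mu t) (mu t) <= B / n.+1%:R.
  move=> n; set N : R := n.+1%:R; have N0 : 0 < N by rewrite ltr0n.
  have NN : N <= 2 * N by lra.
  have dE (t : R) : N <= t -> is_derive t 1 energy (- (2 * slope g K W (m t) (m t))).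
    by move=> Nt; apply: energy_derive; exact: lt_le_trans Nt.
  have [||t] := @MVT_segment R energy
    (fun t => - (2 * slope g K W (m t) (m t))) N (2 * N) NN.
  - by move=> t; rewrite in_itv/= => /andP[/ltW Nt _]; exact: dE.
  - apply: (@derive_within_continuous _ energy
      (fun t => - (2 * slope g K W (m t) (m t)))) => t /andP[Nt _]; exact: dE.
  rewrite in_itv/= => /andP[Nt _] E; exists t; split => //.
  rewrite -(frozenE mu (t := t)); last exact: le_trans (ltW N0) Nt.
  rewrite ler_pdivlMr//.
  have := eB N; have := eB (2 * N); rewrite !ler_norml => /andP[b1 b2] /andP[b3 b4].
  have E2 : 2 * N - N = N by ring.
  by rewrite E2 in E; lra.
by exists t, B.
Qed.

End Energy.

(** * Subsequences of the flow converge to stationary solutions *)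

Unset Implicit Arguments.

Theorem corollary2p11 (R : realType) (d : nat) (M : ptopologicalType)
    (A : smoothManifold R d M) (g : riemannianMetric A)
    (K W : M * M -> R) (C alpha : R) (mu : R -> borelProb R M)
    (M_compact : compact [set: M])
    (K_continuous : continuous K)
    (C_gt0 : 0 < C) (K_ge : forall x y, C <= K (x, y))
    (alpha_gt0 : 0 < alpha) (W_C1alpha : C1_holder_manifold2 A alpha W)
    (W_sym : forall x y, W (x, y) = W (y, x))
    (mu_sol : weak_solution g K W mu) :
  exists (t : nat -> R) (mu_star : borelProb R M),
    [/\ forall n, 0 <= t n,
        t @ \oo --> +oo,
        narrow_cvg \oo (fun n => mu (t n)) mu_star &
        stationary_solution g K W mu_star].
Proof.
have W1 (i j : atlas A) := (W_C1alpha i j).1.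
have [s [B Hs]] := slope_vanishes M_compact W1 K_continuous C_gt0 K_ge W_sym mu_sol.
have [n_ [nu [n_ge nu_cvg]]] := narrow_subsequence
  (manifold_hausdorff A) M_compact (manifold_second_countable A) (mu \o s).
exists (s \o n_), nu.
have t_ge n : n.+1%:R <= s (n_ n).
  by apply: le_trans (Hs (n_ n)).1; rewrite ler_nat ltnS.
split.
- by move=> n; apply: le_trans (t_ge n).
- apply/cvgryPge => a; near=> n; apply: le_trans (t_ge n).
  apply: (@le_trans _ _ n%:R); last by rewrite ler_nat.
  by near: n; exact: nbhs_infty_ger.
- exact: nu_cvg.
apply: (slope0_stationary(g := g) M_compact W1 K_continuous C_gt0 K_ge).
have Sl := slope_cvg (g := g) M_compact W1 K_continuous C_gt0 K_ge nu_cvg nu_cvg.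
apply/eqP; rewrite eq_le (slope_ge0 g M_compact W K_continuous C_gt0 K_ge nu) andbT.
have Bcvg : (fun n => `|B| * harmonic n) @ \oo --> (0 : R).
  by rewrite -(mulr0 `|B|); apply: cvgM; [exact: cvg_cst|exact: cvg_harmonic].
apply: (ler_cvg_to (Sl _) Bcvg); apply: nearW => n.
apply: le_trans (Hs (n_ n)).2 _.
apply: (@le_trans _ _ (`|B| / (n_ n).+1%:R)).
  by rewrite ler_pM2r ?invr_gt0 ?ltr0n// ler_norm.
by rewrite ler_wpM2l// lef_pV2 ?posrE ?ltr0n// ler_nat ltnS.
Unshelve. all: by end_near. Qed.
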